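(* Let $A$ be a filtered-commutative algebra over a field $k$ such that $\mathrm{gr}(A)$ is finitely generated, with the presentation $\mathrm{gr}(A)=P/I$, monomial ordering, Gröbner basis $G$ of $I$, lifts $X_i$ and bases $\mathcal B$, $\tilde{\mathcal B}$ fixed as in the context. Let $J$ be a left ideal of $A$ and let $H$ be a finite ordered generating set of $J$ with $0\notin H$. Consider the following procedure. (1) For $a\in H$ and $g\in G$, let $L=\mathrm{lcm}(\mathrm{LM}_{\mathcal B}(a),\mathrm{LM}(g))$ and $q=L/\mathrm{LM}_{\mathcal B}(a)$. If $\mathrm{red}(\tilde q a,H)\neq 0$, append it to $H$. (2) For $a,b\in H$, let $L=\mathrm{lcm}(\mathrm{LM}_{\mathcal B}(a),\mathrm{LM}_{\mathcal B}(b))$, $t_1=L/\mathrm{LT}_{\mathrm{gr}}(\mathrm{pr}(a))$ and $t_2=L/\mathrm{LT}_{\mathrm{gr}}(\mathrm{pr}(b))$. If $\mathrm{red}(\tilde t_1a-\tilde t_2b,H)\ne 0$, append it to $H$. (3) Repeat (1) and (2) until no more elements can be added to $H$. Then this procedure terminates after finitely many steps, and the final set $H$ (which contains the original one) is a Gröbner basis of the left ideal $J$.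
   Context: Algebras are associative and unital, not necessarily commutative. A (decreasingly) filtered-commutative algebra over a field $k$ is a $k$-algebra $A$ with a filtration by ideals $A=F_0A\supset F_1A\supset F_2A\supset\cdots$ such that $F_pA\cdot F_qA\subset F_{p+q}A$, $F_{p_{\mathrm{nul}}}A=0$ for some $p_{\mathrm{nul}}>0$, and the associated graded algebra $\mathrm{gr}(A)=\bigoplus_p F_pA/F_{p+1}A$ is commutative. For nonzero $a\in A$, $v(a)$ is the maximal $p$ with $a\in F_pA$, and $\mathrm{pr}(a)\in \mathrm{gr}_p(A)=F_pA/F_{p+1}A$ is the image of $a$ for $p=v(a)$; one says $a$ projects to $\mathrm{pr}(a)$. Also $\mathrm{pr}(0)=0$, $v(0)=\infty$. Standing setting: $\mathrm{gr}(A)$ is finitely generated, and $\mathrm{gr}(A)=P/I$ with $P=k[x_1,\dots,x_n]$ graded so that the $x_i$ are homogeneous and $I$ is a homogeneous ideal; $|f|$ is the degree of a homogeneous element. $P$ is equipped with a degree-reversed admissible monomial ordering: a total ordering on monomials such that for all monomials $M,N,L$: (i) $M\le N\iff ML\le NL$; (ii) $|L|=0\Rightarrow M\le ML$; (iii) $|M|>|N|\Rightarrow M<N$. For nonzero $f\in P$, $\mathrm{LM}(f)$ is the largest monomial occurring in $f$. $G$ is a Gröbner basis of $I$: a finite generating set of $I$ (of nonzero elements) with $(\mathrm{LM}(f):0\ne f\in I)=(\mathrm{LM}(g):g\in G)$. Let $\mathcal B$ be the set of monomials $m$ with $\mathrm{LM}(g)\nmid m$ for all $g\in G$; modulo $I$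 it is a $k$-basis of $\mathrm{gr}(A)$. For nonzero $f\in\mathrm{gr}(A)$ written uniquely as $f=c_1m_1+\dots+c_lm_l \bmod I$ with $c_i\in k\setminus\{0\}$, $m_i\in\mathcal B$, $m_1>\dots>m_l$, put $\mathrm{LM}_{\mathrm{gr}}(f)=m_1$, $\mathrm{LT}_{\mathrm{gr}}(f)=c_1m_1$. Fix $X_i\in A$ projecting to (the class of) $x_i$. For $m=x_1^{r_1}\cdots x_n^{r_n}\in\mathcal B$ let $\tilde m=X_1^{r_1}\cdots X_n^{r_n}\in A$; $\tilde{\mathcal B}=\{\tilde m:m\in\mathcal B\}$ is a $k$-basis of $A$, ordered as $\mathcal B$ (both are well-ordered). For $f=\sum c_im_i\bmod I$ in $\mathrm{gr}(A)$ with $m_i\in\mathcal B$ put $\tilde f=\sum c_i\tilde m_i\in A$; for an element of $P$, the tilde is applied to its class in $\mathrm{gr}(A)$. For nonzero $a=c_1\tilde m_1+\dots+c_l\tilde m_l$ ($c_i\in k\setminus\{0\}$, $m_i\in\mathcal B$, $m_1>\dots>m_l$) put $\mathrm{LM}_A(a)=\tilde m_1$, $\mathrm{LT}_A(a)=c_1\tilde m_1$, $\mathrm{LM}_{\mathcal B}(a)=m_1$. One has $\mathrm{LT}_{\mathrm{gr}}(\mathrm{pr}(a))=c_1m_1$. Gröbner basis of a left ideal $J\subset A$: a finite generating set $H$ of $J$ such that the ideals $(\mathrm{LM}_{\mathcal B}(a):0\ne a\in J)$ and $(\mathrm{LM}_{\mathcal B}(h):h\in H)$ of $P$ are equal. Reduction: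 let $a=c_1\tilde m_1+\dots+c_l\tilde m_l$ with $c_i\in k\setminus\{0\}$, $m_i\in\mathcal B$, $m_1>\dots>m_l$, and let $b\neq 0$ with $\mathrm{LT}_A(b)=c\tilde m$. A summand $c_i\tilde m_i$ is reducible by $b$ if $m\mid m_i$; $a$ is reducible by $b$ if some summand is. With $i$ the smallest such index, $\mathrm{red}_1(a,b)=a-\frac{c_i}{c}\widetilde{(m_i/m)}\,b$. For a finite ordered set $H$ of nonzero elements, $a$ is reducible by $H$ if it is reducible by some $h\in H$; then take the largest summand of $a$ reducible by an element of $H$ and the first $h\in H$ reducing it, and put $\mathrm{red}_1(a,H)=\mathrm{red}_1(a,h)$. Iterating until the result is no longer reducible by $H$ (this terminates) gives $\mathrm{red}(a,H)$. In the procedure, new elements are appended at the end of the ordered set $H$. *)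

(* Defs.v *)
From HB Require Import structures.
From mathcomp Require Import all_boot all_order all_algebra.
From mathcomp Require Import generic_quotient ring_quotient.
From mathcomp Require Import mpoly.
From Stdlib Require Import ClassicalEpsilon.

Set Implicit Arguments.
Unset Strict Implicit.
Unset Printing Implicit Defensive.

Import GRing.Theory.
Local Open Scope ring_scope.
Local Open Scope quotient_scope.

Record filtration (k : fieldType) (A : algType k) := Filtration {
  filt :> nat -> {pred A};
  pnul : nat;
  filt0 : forall a, a \in filt 0;
  filtS : forall p, {subset filt p.+1 <= filt p};
  filt_zero : forall p, 0 \in filt p;
  filt_add : forall p, {in filt p &, forall a b, a + b \in filt p};
  filt_mull : forall p a, {in filt p, forall b, a * b \in filt p};
  filt_mulr : forall p a, {in filt p, forall b, b * a \in filt p};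
  filt_mul : forall p q a b,
    a \in filt p -> b \in filt q -> a * b \in filt (p + q);
  pnul_gt0 : (0 < pnul)%N;
  filt_pnul : forall a, a \in filt pnul -> a = 0
}.

(* gr(A) is built as the quotient of the Rees algebra
   (+)_p F_p t^p, a subalgebra of {poly A}, by the ideal (+)_p F_(p+1) t^p. *)
Section AssociatedGraded.

Context (k : fieldType) (A : algType k) (F : filtration A).
Implicit Types (a b : A) (p q : nat).

Lemma filt_opp p : {in F p, forall a, - a \in F p}.
Proof. by move=> a Fa; rewrite -mulN1r filt_mull. Qed.

Definition rees_pred : {pred {poly A}} :=
  fun f => all (fun i => f`_i \in F i) (iota 0 (size f)).

Definition grker_pred : {pred {poly A}} :=
  fun f => all (fun i => f`_i \in F i.+1) (iota 0 (size f)).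

Lemma rees_predP (f : {poly A}) :
  reflect (forall i, f`_i \in F i) (f \in rees_pred).
Proof.
apply: (iffP allP) => [Ff i | Ff i _]; last exact: Ff.
have [ltif | lefi] := ltnP i (size f); last by rewrite nth_default ?filt_zero.
by apply: Ff; rewrite mem_iota.
Qed.

Lemma grker_predP (f : {poly A}) :
  reflect (forall i, f`_i \in F i.+1) (f \in grker_pred).
Proof.
apply: (iffP allP) => [Ff i | Ff i _]; last exact: Ff.
have [ltif | lefi] := ltnP i (size f); last by rewrite nth_default ?filt_zero.
by apply: Ff; rewrite mem_iota.
Qed.

Lemma rees_subring_closed : subring_closed rees_pred.
Proof.
split=> [|f g /rees_predP Ff /rees_predP Fg|f g /rees_predP Ff /rees_predP Fg];
  apply/rees_predP => i.
- by rewrite coef1; case: i => [|i]; rewrite ?filt0 ?filt_zero.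
- by rewrite coefB filt_add ?filt_opp.
- rewrite coefM; elim/big_ind: _ => [||j _]; first exact: filt_zero.
    exact: filt_add.
  by rewrite -[X in F X](subnKC (ltn_ord j : (j <= i)%N)) filt_mul.
Qed.

HB.instance Definition _ :=
  GRing.isSubringClosed.Build {poly A} rees_pred rees_subring_closed.

Record rees := Rees { rees_val :> {poly A}; rees_valP : rees_val \in rees_pred }.

HB.instance Definition _ := [isSub for rees_val].
HB.instance Definition _ := [Choice of rees by <:].
HB.instance Definition _ := [SubChoice_isSubNzRing of rees by <:].

Definition grker : {pred rees} := fun f => rees_val f \in grker_pred.

Lemma grkerP (f : rees) : reflect (forall i, (val f)`_i \in F i.+1) (f \in grker).
Proof. exact: grker_predP. Qed.

Lemma grker_zmod_closed : zmod_closed grker.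
Proof.
split=> [|f g /grkerP Ff /grkerP Fg]; apply/grkerP => i.
  by rewrite rmorph0 coef0 filt_zero.
by rewrite rmorphB coefB filt_add ?filt_opp.
Qed.

HB.instance Definition _ := GRing.isZmodClosed.Build rees grker grker_zmod_closed.

Lemma grker_mull f g : g \in grker -> f * g \in grker.
Proof.
move=> /grkerP Fg; apply/grkerP => i; rewrite rmorphM coefM.
elim/big_ind: _ => [||j _]; [exact: filt_zero | exact: filt_add |].
rewrite -[X in F X.+1](subnKC (ltn_ord j : (j <= i)%N)) -addnS.
by rewrite filt_mul ?Fg //; apply: (rees_predP _ (valP f)).
Qed.

Lemma grker_mulr f g : f \in grker -> f * g \in grker.
Proof.
move=> /grkerP Ff; apply/grkerP => i; rewrite rmorphM coefM.
elim/big_ind: _ => [||j _]; [exact: filt_zero | exact: filt_add |].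
rewrite -[X in F X.+1](subnKC (ltn_ord j : (j <= i)%N)) -addSn.
by rewrite filt_mul ?Ff //; apply: (rees_predP _ (valP g)).
Qed.

Definition gr := Quotient.quot grker.

HB.instance Definition _ := GRing.Zmodule.on gr.
HB.instance Definition _ := EqQuotient.on gr.

Definition gr_one : gr := \pi_gr 1.
Definition gr_mul := lift_op2 gr *%R.

Lemma gr_piE (f g : rees) : (\pi_gr f = \pi_gr g) <-> (f - g \in grker).
Proof. by rewrite Quotient.idealrBE; split=> [->|/eqP]. Qed.

Lemma gr_pi_mul f g : \pi_gr (f * g) = gr_mul (\pi_gr f) (\pi_gr g).
Proof.
unlock gr_mul; apply/gr_piE.
have Ef : f - repr (\pi_gr f) \in grker by apply/gr_piE; rewrite reprK.
have Eg : g - repr (\pi_gr g) \in grker by apply/gr_piE; rewrite reprK.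
rewrite -[f * g](addrNK (f * repr (\pi_gr g))) -mulrBr -addrA -mulrBl.
by rewrite rpredD //; [exact: grker_mull | exact: grker_mulr].
Qed.

Lemma gr_pi_add (f g : rees) : \pi_gr (f + g) = \pi_gr f + \pi_gr g.
Proof. exact: Quotient.pi_add. Qed.

Lemma gr_mulA : associative gr_mul.
Proof.
by move=> x y z; rewrite -[x]reprK -[y]reprK -[z]reprK -!gr_pi_mul mulrA.
Qed.

Lemma gr_mul1 : left_id gr_one gr_mul.
Proof. by move=> x; rewrite -[x]reprK -gr_pi_mul mul1r. Qed.

Lemma gr_mulr1 : right_id gr_one gr_mul.
Proof. by move=> x; rewrite -[x]reprK -gr_pi_mul mulr1. Qed.

Lemma gr_mulDl : left_distributive gr_mul +%R.
Proof.
move=> x y z; rewrite -[x]reprK -[y]reprK -[z]reprK.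
by rewrite -gr_pi_add -!gr_pi_mul -gr_pi_add mulrDl.
Qed.

Lemma gr_mulDr : right_distributive gr_mul +%R.
Proof.
move=> x y z; rewrite -[x]reprK -[y]reprK -[z]reprK.
by rewrite -gr_pi_add -!gr_pi_mul -gr_pi_add mulrDr.
Qed.

Lemma gr_one_neq0 : gr_one != 0.
Proof.
apply/eqP => E; have : (1 : rees) - 0 \in grker.
  by apply/gr_piE; rewrite [LHS]E; symmetry; exact: pi_zeror.
rewrite subr0 => /grkerP/(_ 0); rewrite rmorph1 coef1 /= => F1.
have F1n n : (1 : A) \in F n.
  elim: n => [|n IHn]; first exact: filt0.
  by rewrite -[1]mulr1 -[n.+1]addn1 filt_mul.
by have /eqP := filt_pnul (F1n (pnul F)); rewrite oner_eq0.
Qed.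

HB.instance Definition _ := GRing.Zmodule_isNzRing.Build gr
  gr_mulA gr_mul1 gr_mulr1 gr_mulDl gr_mulDr gr_one_neq0.

Lemma rees_const_subproof (c : k) : (c%:A)%:P \in rees_pred.
Proof.
by apply/rees_predP => -[|i]; rewrite coefC ?filt0 ?filt_zero.
Qed.

Definition rees_const c : rees := Rees (rees_const_subproof c).

Definition gr_scale (c : k) (u : gr) : gr := \pi_gr (rees_const c) * u.

Lemma rees_constD c d : rees_const (c + d) = rees_const c + rees_const d.
Proof. by apply: val_inj; rewrite rmorphD /= scalerDl polyCD. Qed.

Lemma rees_constM c d : rees_const (c * d) = rees_const c * rees_const d.
Proof.
by apply: val_inj; rewrite rmorphM /= -polyCM -scalerAl mul1r scalerA.
Qed.

Lemma rees_const1 : rees_const 1 = 1.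
Proof. by apply: val_inj; rewrite rmorph1 /= scale1r. Qed.

Lemma rees_constC c f : f * rees_const c = rees_const c * f.
Proof.
apply: val_inj; rewrite !rmorphM /=; apply/polyP => i.
by rewrite coefMC coefCM -scalerAl -scalerAr mul1r mulr1.
Qed.

Lemma gr_scaleA c d u : gr_scale c (gr_scale d u) = gr_scale (c * d) u.
Proof. by rewrite /gr_scale mulrA rees_constM gr_pi_mul. Qed.

Lemma gr_scale1 : left_id 1 gr_scale.
Proof. by move=> u; rewrite /gr_scale rees_const1 -[RHS]mul1r. Qed.

Lemma gr_scaleDr : right_distributive gr_scale +%R.
Proof. by move=> c u v; rewrite /gr_scale mulrDr. Qed.

Lemma gr_scaleDl u : {morph gr_scale^~ u : c d / c + d}.
Proof. by move=> c d; rewrite /gr_scale rees_constD gr_pi_add mulrDl. Qed.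

HB.instance Definition _ := GRing.Zmodule_isLmodule.Build k gr
  gr_scaleA gr_scale1 gr_scaleDr gr_scaleDl.

Lemma gr_scaleAl (c : k) (u v : gr) : c *: (u * v) = (c *: u) * v.
Proof. exact: mulrA. Qed.

HB.instance Definition _ := GRing.Lmodule_isLalgebra.Build k gr gr_scaleAl.

Lemma gr_scaleAr (c : k) (u v : gr) : c *: (u * v) = u * (c *: v).
Proof.
rewrite -[u]reprK -[v]reprK.
rewrite -[LHS]/(gr_mul _ (gr_mul _ _)) -[RHS]/(gr_mul _ (gr_mul _ _)).
by rewrite -!gr_pi_mul !mulrA rees_constC.
Qed.

HB.instance Definition _ := GRing.Lalgebra_isAlgebra.Build k gr gr_scaleAr.

Definition rees_monom p a : rees := insubd (0 : rees) (a%:P * 'X^p).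

(* For a in F_p, the class of a in gr_p(A) = F_p / F_(p+1). *)
Definition gr_class p a : gr := \pi_gr (rees_monom p a).

Lemma rees_monomE p a : a \in F p -> val (rees_monom p a) = a%:P * 'X^p.
Proof.
move=> Fa; rewrite insubdK //; apply/rees_predP => i.
by rewrite coefCM coefXn; case: eqP => [->|_]; rewrite ?mulr1 ?mulr0 ?filt_zero.
Qed.

Lemma gr_class_eq0 p a : a \in F p -> (gr_class p a = 0) <-> (a \in F p.+1).
Proof.
move=> Fa; have -> : (0 : gr) = \pi_gr 0 by symmetry; exact: pi_zeror.
split=> [/gr_piE|Fa1]; last first.
  apply/gr_piE/grkerP => i; rewrite subr0 rees_monomE // coefCM coefXn.
  by case: eqP => [->|_]; rewrite ?mulr1 ?mulr0 ?filt_zero.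
by rewrite subr0 => /grkerP/(_ p); rewrite rees_monomE // coefCM coefXn eqxx mulr1.
Qed.

Lemma gr_classM p q a b : a \in F p -> b \in F q ->
  gr_class p a * gr_class q b = gr_class (p + q) (a * b).
Proof.
move=> Fa Fb; rewrite -[LHS]/(gr_mul _ _) -gr_pi_mul; congr (\pi_gr _).
apply: val_inj; apply: (etrans (rmorphM (val : rees -> {poly A}) _ _)).
rewrite [X in X * _]rees_monomE // [X in _ * X]rees_monomE //.
rewrite rees_monomE ?filt_mul //.
rewrite polyCM -!mulrA; congr (_ * _).
by rewrite mulrA -commr_polyXn -mulrA -exprD.
Qed.

Definition gr_homog p (u : gr) := exists2 a, a \in F p & u = gr_class p a.

(* Meaningful for a <> 0 only. *)
Definition fval a : nat := \max_(p < pnul F | a \in F p) p.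

Definition pr a : gr := gr_class (fval a) a.

End AssociatedGraded.

(* The left ideal spanned by S; for commutative R, the ideal (S). *)
Definition ideal_span (R : nzRingType) (S : R -> Prop) (x : R) : Prop :=
  exists2 s : seq (R * R), (forall c, c \in s -> S c.2)
    & x = \sum_(c <- s) c.1 * c.2.

Definition left_ideal (R : nzRingType) (J : {pred R}) : Prop :=
  [/\ 0 \in J, {in J &, forall x y, x + y \in J}
    & forall a, {in J, forall x, a * x \in J}].

Section Monomials.

Context (n : nat) (d : 'I_n -> nat).
Implicit Types (le : rel 'X_{1..n}) (L M N : 'X_{1..n}).

Definition wdeg M : nat := (\sum_(i < n) d i * M i)%N.

Record degrev_admissible le : Prop := DegrevAdmissible {
  dra_refl : reflexive le;
  dra_anti : antisymmetric le;
  dra_trans : transitive le;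
  dra_total : total le;
  dra_mul : forall M N L, le M N <-> le (M + L)%MM (N + L)%MM;
  dra_deg0 : forall M L, wdeg L = 0%N -> le M (M + L)%MM;
  dra_deg : forall M N, (wdeg N < wdeg M)%N -> le M N /\ M != N
}.

End Monomials.

Section LeadingMonomials.

Context (k : fieldType) (n : nat) (le : rel 'X_{1..n}).
Implicit Types (f : {mpoly k[n]}) (m : 'X_{1..n}) (G : seq {mpoly k[n]}).

(* The monomials of f, largest first. *)
Definition monoms f : seq 'X_{1..n} := sort (fun m m' => le m' m) (msupp f).

(* LM and LC are meaningful for f <> 0 only. *)
Definition LM f : 'X_{1..n} := head 0%MM (monoms f).
Definition LC f : k := f@_(LM f).

Definition groebner (I : {mpoly k[n]} -> Prop) G : Prop :=
  [/\ 0 \notin G,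
      forall f, I f <-> ideal_span (fun g => g \in G) f
    & forall f,
        ideal_span (fun x => exists f0, [/\ f0 != 0, I f0 & x = 'X_[LM f0]]) f
        <-> ideal_span (fun x => exists2 g, g \in G & x = 'X_[LM g]) f].

(* Membership in B. *)
Definition standard G m : bool := all (fun g => ~~ (LM g <= m)%MM) G.

(* The coordinates of v on the basis of B-monomials, as a polynomial supported
   on B, where ev is the linear map sending m in B to the corresponding basis
   vector. *)
Definition coords (V : Type) G (ev : {mpoly k[n]} -> V) (v : V) :
    {mpoly k[n]} :=
  epsilon (inhabits 0) (fun f => all (standard G) (msupp f) /\ ev f = v).

End LeadingMonomials.

Section Procedure.

Context (k : fieldType) (A : algType k) (F : filtration A) (n : nat).
Context (phi : {lrmorphism {mpoly k[n]} -> gr F}) (le : rel 'X_{1..n}).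
Context (G : seq {mpoly k[n]}) (X : 'I_n -> A).
Implicit Types (a b h : A) (m : 'X_{1..n}) (f : {mpoly k[n]}) (H : seq A).

Definition coords_gr (u : gr F) : {mpoly k[n]} := coords le G phi u.
Definition LM_gr (u : gr F) : 'X_{1..n} := LM le (coords_gr u).
Definition LC_gr (u : gr F) : k := LC le (coords_gr u).

Definition tmonom m : A := \prod_(i < n) X i ^+ m i.
Definition tcomb f : A := \sum_(m <- msupp f) f@_m *: tmonom m.
Definition tilde_gr (u : gr F) : A := tcomb (coords_gr u).
Definition tilde f : A := tilde_gr (phi f).

Definition coordsA a : {mpoly k[n]} := coords le G tcomb a.
Definition LM_B a : 'X_{1..n} := LM le (coordsA a).
Definition LC_A a : k := LC le (coordsA a).

Definition red1_by a b : A :=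
  if [seq m <- monoms le (coordsA a) | (LM_B b <= m)%MM] is m :: _
  then a - ((coordsA a)@_m / LC_A b) *: (tmonom (m - LM_B b)%MM * b)
  else a.

Definition reducible_monoms H a : seq 'X_{1..n} :=
  [seq m <- monoms le (coordsA a) | has (fun h => (LM_B h <= m)%MM) H].

Definition reducible H a : bool := reducible_monoms H a != [::].

Definition red1 H a : A :=
  if reducible_monoms H a is m :: _
  then red1_by a (nth 0 H (find (fun h => (LM_B h <= m)%MM) H))
  else a.

(* red1 H fixes irreducible elements, so the number of iterations chosen is
   immaterial as soon as the result is irreducible. *)
Definition red H a : A :=
  iter (epsilon (inhabits 0%N) (fun N => ~~ reducible H (iter N (red1 H) a)))
       (red1 H) a.

Definition red_of_G H a (g : {mpoly k[n]}) : A :=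
  let q := (mlcm (LM_B a) (LM le g) - LM_B a)%MM in
  red H (tilde 'X_[q] * a).

(* L / LT_gr(pr a), where LT_gr(pr a) = c m is divided as a term. *)
Definition cofactor_of (L : 'X_{1..n}) a : {mpoly k[n]} :=
  (LC_gr (pr F a))^-1 *: 'X_[(L - LM_gr (pr F a))%MM].

Definition red_of_pair H a b : A :=
  let L := mlcm (LM_B a) (LM_B b) in
  red H (tilde (cofactor_of L a) * a - tilde (cofactor_of L b) * b).

Inductive step H : seq A -> Prop :=
| Step1 a g of a \in H & g \in G & red_of_G H a g != 0 :
    step H (rcons H (red_of_G H a g))
| Step2 a b of a \in H & b \in H & red_of_pair H a b != 0 :
    step H (rcons H (red_of_pair H a b)).

Inductive steps H : seq A -> Prop :=
| StepsRefl : steps H H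
| StepsNext H1 H2 of step H H1 & steps H1 H2 : steps H H2.

Definition saturated H : Prop := forall H', ~ step H H'.

Definition left_groebner (J : {pred A}) H : Prop :=
  [/\ 0 \notin H,
      forall a, a \in J <-> ideal_span (fun h => h \in H) a
    & forall f : {mpoly k[n]},
        ideal_span (fun x => exists a, [/\ a != 0, a \in J & x = 'X_[LM_B a]]) f
        <-> ideal_span (fun x => exists2 h, h \in H & x = 'X_[LM_B h]) f].

End Procedure.

(* Main.v *)
Require Import Defs.
From HB Require Import structures.
From mathcomp Require Import all_boot all_order all_algebra.
From mathcomp Require Import generic_quotient ring_quotient.
From mathcomp Require Import mpoly.
From Stdlib Require Import Classical ClassicalEpsilon.

(* Modulo lower terms, the lifted monomials multiply as in P: the product of
   the lifts of M and N differs from the lift of MN by an element of filtration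
   degree |MN| + 1, whose standard monomials are all smaller than MN by (iii).
   So leading terms behave as for polynomials as long as the product of the
   leading monomials is standard.  When it is not, or when the leading terms
   cancel, the products of step (1), resp. the S-pairs of step (2), rewrite an
   expression of an element of J as a combination of products (monomial) * h
   with smaller formal leading monomials.  This descent stops, because the
   ordering is well-founded in bounded degree (Dickson's lemma) and products of
   large degree vanish; at the end no cancellation occurs, and the leading
   monomial of the element is a multiple of that of some h.  The procedure
   terminates by Dickson's lemma again, the leading monomial of each new
   element being divisible by none of the previous ones. *)

Set Implicit Arguments.
Unset Strict Implicit.
Unset Printing Implicit Defensive.

Import GRing.Theory.
Local Open Scope ring_scope.

(** * Infinite descending chains and Dickson's lemma *)

Section InfiniteChains.

(** By dependent choice: an inaccessible point has an inaccessible predecessor, and iterating this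
    choice builds an infinite chain. *)
Lemma Acc_no_chain (T : Type) (R : T -> T -> Prop) (x : T) :
  (forall u : nat -> T, u 0 = x -> ~ forall i, R (u i.+1) (u i)) -> Acc R x.
Proof.
move=> nochain; apply: NNPP => nAx.
have next (y : {z | ~ Acc R z}) : {z : {z | ~ Acc R z} | R (sval z) (sval y)}.
  case: y => y nAy /=; apply: constructive_indefinite_description.
  apply: NNPP => nz; apply: nAy; constructor => z Rzy; apply: NNPP => nAz.
  by apply: nz; exists (exist _ z nAz).
pose u i := iter i (fun y => sval (next y)) (exist _ x nAx).
apply: (nochain (fun i => sval (u i))) => // i; exact: (svalP (next (u i))).
Qed.

(** Each chosen index minimizes [v] among all indices after the previously chosen one, and minima
    over shrinking tails do not decrease. *)
Lemma nat_nondecreasing_subseq (v : nat -> nat) :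
  exists s : nat -> nat, [/\ forall i, s i < s i.+1
    & forall i j, i <= j -> v (s i) <= v (s j)]%N.
Proof.
have next p : {q | p < q /\ forall q', p < q' -> v q <= v q'}%N.
  apply: constructive_indefinite_description.
  (* The minimizer is found by descent on a bound [b] of the value reached so far. *)
  suff min b q : (v q <= b -> p < q ->
      exists q, p < q /\ forall q', p < q' -> v q <= v q')%N.
    exact: (min (v p.+1) p.+1).
  elim: b q => [|b IHb] q leqb ltpq.
    by exists q; split=> // q' _; move: leqb; rewrite leqn0 => /eqP ->.
  have [[q' ltpq' ltv]|nq] := classic (exists2 q', p < q' & v q' < v q)%N.
    by apply: (IHb q') => //; rewrite -ltnS (leq_trans ltv).
  exists q; split=> // q' ltpq'; rewrite leqNgt; apply/negP => ltv.
  by apply: nq; exists q'.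
(* The shift to [i.+1] makes every [s i] a value of [nx], hence a minimizer; the index 0 itself need
   not be one. *)
pose nx p := sval (next p); pose s i := iter i.+1 nx 0%N.
have ltnx p : (p < nx p)%N by case: (svalP (next p)).
have minnx p q : (p < q -> v (nx p) <= v q)%N by case: (svalP (next p)) => _; apply.
exists s; split=> [i|i j lij]; first exact: ltnx.
have sinc p : (iter p nx 0 <= iter p.+1 nx 0)%N by exact: ltnW (ltnx _).
have := homo_leq leqnn leq_trans sinc => smono.
by apply: minnx; apply: leq_ltn_trans (smono _ _ lij) (ltnx _).
Qed.

(** Dickson's lemma for sequences. Subsequences are extracted one coordinate at a time, since
    monotonicity in the earlier coordinates survives extraction. *)
Lemma dickson_subseq (n : nat) (u : nat -> 'X_{1..n}) :
  exists s : nat -> nat, [/\ forall i, (s i < s i.+1)%N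
    & forall i j, (i <= j)%N -> (u (s i) <= u (s j))%MM].
Proof.
suff coords_subseq (r : seq 'I_n) : exists s : nat -> nat,
    [/\ forall i, (s i < s i.+1)%N & forall c i j, c \in r -> (i <= j)%N ->
        (u (s i) c <= u (s j) c)%N].
  have [s [sinc smono]] := coords_subseq (enum 'I_n); exists s; split=> // i j lij.
  by apply/mnm_lepP => c; rewrite smono ?mem_enum.
elim: r => [|c r [s [sinc smono]]]; first by exists id.
have [t [tinc tmono]] := nat_nondecreasing_subseq (fun i => u (s i) c).
exists (s \o t); split=> [i|c' i j] /=.
  exact: (homo_ltn ltn_trans sinc).
have tle i' j' : (i' <= j' -> t i' <= t j')%N.
  by apply: (homo_leq leqnn leq_trans) => p; apply: ltnW.
rewrite inE => /orP[/eqP ->|rc'] lij; first exact: tmono.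
by rewrite smono ?tle.
Qed.

End InfiniteChains.

(** * Degree-reversed monomial orderings *)

Section MonomialOrder.

Context (n : nat) (d : 'I_n -> nat) (le : rel 'X_{1..n}).
Context (le_adm : degrev_admissible d le).
Implicit Types (L M N : 'X_{1..n}).

Definition slt M N := le M N && (M != N).

Let lexx := dra_refl le_adm.
Let le_trans := dra_trans le_adm.
Let le_anti := dra_anti le_adm.

Lemma wdegD M N : wdeg d (M + N) = (wdeg d M + wdeg d N)%N.
Proof.
by rewrite /wdeg -big_split; apply: eq_bigr => i _; rewrite mnmDE mulnDr.
Qed.

Lemma sltW M N : slt M N -> le M N.
Proof. by case/andP. Qed.

Lemma slt_nle M N : slt M N = ~~ le N M.
Proof.
apply/andP/idP => [[lMN]|nlNM].
  by apply: contra => lNM; apply/eqP/le_anti/andP.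
split; last by apply: contraNneq nlNM => ->; exact: lexx.
by have := dra_total le_adm M N; rewrite (negPf nlNM) orbF.
Qed.

Lemma le_slt_trans N M L : le M N -> slt N L -> slt M L.
Proof. rewrite !slt_nle => lMN; apply: contra => lLM; exact: le_trans lMN. Qed.

Lemma slt_le_trans N M L : slt M N -> le N L -> slt M L.
Proof.
rewrite !slt_nle => nlNM lNL; apply: contra nlNM => lLM.
exact: le_trans lLM.
Qed.

Lemma slt_trans N M L : slt M N -> slt N L -> slt M L.
Proof. by move=> ltMN /sltW; apply: slt_le_trans. Qed.

Lemma le_add2l L M N : le (L + M)%MM (L + N)%MM = le M N.
Proof.
rewrite ![(L + _)%MM]addmC.
by apply/idP/idP; apply dra_mul with (1 := le_adm).
Qed.

Lemma le_add2r L M N : le (M + L)%MM (N + L)%MM = le M N.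
Proof. by rewrite ![(_ + L)%MM]addmC le_add2l. Qed.

Lemma slt_add2l L M N : slt (L + M)%MM (L + N)%MM = slt M N.
Proof. by rewrite !slt_nle le_add2l. Qed.

Lemma slt_add2r L M N : slt (M + L)%MM (N + L)%MM = slt M N.
Proof. by rewrite !slt_nle le_add2r. Qed.

Lemma slt_wdeg M N : (wdeg d N < wdeg d M)%N -> slt M N.
Proof. by move=> /(dra_deg le_adm)[lMN neqMN]; apply/andP. Qed.

Lemma le_wdeg M N : le M N -> (wdeg d N <= wdeg d M)%N.
Proof.
move=> lMN; rewrite leqNgt; apply/negP => /slt_wdeg.
by rewrite slt_nle lMN.
Qed.

(* A strictly decreasing sequence has a subsequence increasing for
   divisibility; each of its quotients has positive weight, by (ii), so that
   the weights are unbounded. *)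
Lemma slt_wf (K : nat) :
  well_founded (fun N M => slt N M /\ (wdeg d N < K)%N).
Proof.
move=> M0; apply: Acc_no_chain => u _ udec.
have [s [sinc smono]] := dickson_subseq u.
have ulK i : (wdeg d (u i.+1) < K)%N by case: (udec i).
have udec1 i j : (i < j)%N -> slt (u j) (u i).
  apply: (homo_ltn (r := fun M N => slt N M)).
    by move=> N M L lNM lLN; apply: slt_trans lLN lNM.
  by move=> p; case: (udec p).
have sw i : (i <= wdeg d (u (s i)))%N.
  elim: i => [//|i IHi]; apply: (leq_ltn_trans IHi).
  have := submK (smono _ _ (leqnSn i)); set L := (u _ - u _)%MM => eqL.
  rewrite -eqL wdegD -[X in (X < _)%N]add0n ltn_add2r lt0n.
  apply/negP => /eqP /(dra_deg0 le_adm (u (s i))).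
  by rewrite addmC eqL => lui; have := udec1 _ _ (sinc i); rewrite slt_nle lui.
(* The weight of [u 0] is not bounded by [K], so [s K.+1] has to be a successor; it is, being larger
   than [s K]. *)
have := sw K.+1; case: (s K.+1) (sinc K) => // p _ lK.
by have := leq_trans lK (ltnW (ulK p)); rewrite ltnn.
Qed.

End MonomialOrder.

(** * Leading monomials of polynomials *)

Section LeadingTerm.

Context (k : fieldType) (n : nat) (d : 'I_n -> nat) (le : rel 'X_{1..n}).
Context (le_adm : degrev_admissible d le).
Implicit Types (f g : {mpoly k[n]}) (m : 'X_{1..n}).

Lemma ge_trans : transitive (fun m m' => le m' m).
Proof. by move=> m1 m2 m3 l12 l23; exact: (dra_trans le_adm) l23 l12. Qed.

Lemma ge_total : total (fun m m' => le m' m).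
Proof. by move=> m m'; apply: (dra_total le_adm). Qed.

Lemma mem_monoms f : monoms le f =i msupp f.
Proof. exact: mem_sort. Qed.

(** [monoms] is sorted in decreasing order, and filtering keeps it so. The trivial property gives
    [LM]; divisibility properties give the monomial treated by a reduction step. *)
Lemma filter_monoms f (P : pred 'X_{1..n}) m s :
  [seq m <- monoms le f | P m] = m :: s ->
  [/\ m \in msupp f, P m & forall m', m' \in msupp f -> P m' -> le m' m].
Proof.
move=> fE.
have inE' m' : (m' \in m :: s) = P m' && (m' \in msupp f).
  by rewrite -fE mem_filter mem_monoms.
have /andP[Pm fm] : P m && (m \in msupp f) by rewrite -inE' mem_head.
split=> // m' fm' Pm'.
have: m' \in m :: s by rewrite inE' Pm'.
rewrite inE => /orP[/eqP -> |sm']; first exact: (dra_refl le_adm).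
have: sorted (fun m m' => le m' m) (m :: s).
  rewrite -fE; apply: (sorted_filter ge_trans); exact: (sort_sorted ge_total).
by move=> /(order_path_min ge_trans) /allP /(_ _ sm').
Qed.

Lemma LM_spec f : f != 0 ->
  LM le f \in msupp f /\ forall m, m \in msupp f -> le m (LM le f).
Proof.
rewrite /LM -msupp_eq0 -size_eq0 -(size_sort (fun m m' => le m' m)).
rewrite -/(monoms le f); case fE: (monoms le f) => [//|m s] _ /=.
have [|fm _ maxm] := @filter_monoms f predT m s; first by rewrite filter_predT.
by split=> // m' fm'; apply: maxm.
Qed.

Lemma LM_max f M : M \in msupp f -> (forall m, m \in msupp f -> le m M) ->
  LM le f = M.
Proof.
move=> fM maxM.
have nzf : f != 0 by apply: contraTneq fM => ->; rewrite msupp0.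
have [fLM maxLM] := LM_spec nzf.
by apply: (dra_anti le_adm); rewrite maxM //= maxLM.
Qed.

Lemma LC_neq0 f : f != 0 -> LC le f != 0.
Proof. by move=> /LM_spec[]; rewrite mcoeff_msupp. Qed.

End LeadingTerm.

(** * Ideals generated by monomials *)

Section MonomialIdeals.

Context (k : fieldType) (n : nat).
Implicit Types (S : {mpoly k[n]} -> Prop) (m : 'X_{1..n}).

Lemma ideal_span_sub (R : nzRingType) (S T : R -> Prop) (x : R) :
  (forall y, S y -> ideal_span T y) -> ideal_span S x -> ideal_span T x.
Proof.
move=> sST [s Ss ->] {x}; elim: s Ss => [|[a y] s IHs] Ss.
  by rewrite big_nil; exists [::]; rewrite ?big_nil.
rewrite big_cons /=.
have [|t Tt ->] := IHs; first by move=> c sc; apply: Ss; rewrite inE sc orbT.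
have [/= r Tr ->] := sST y (Ss (a, y) (mem_head _ _)).
exists ([seq (a * c.1, c.2) | c <- r] ++ t).
  move=> c; rewrite mem_cat => /orP[/mapP[c' rc' ->]|].
    exact: (Tr _ rc').
  exact: Tt.
rewrite big_cat big_map mulr_sumr; congr (_ + _).
by apply: eq_bigr => c _; rewrite mulrA.
Qed.

Lemma ideal_span_mem (R : nzRingType) (S : R -> Prop) (x : R) :
  S x -> ideal_span S x.
Proof.
move=> Sx; exists [:: (1, x)]; last by rewrite big_seq1 mul1r.
by move=> c; rewrite inE => /eqP ->.
Qed.

(** The coefficient at [m] of some product in the combination is nonzero, and every monomial of that
    product is a multiple of its generator. *)
Lemma ideal_span_monomial (P : 'X_{1..n} -> Prop) m :
  ideal_span (fun x : {mpoly k[n]} => exists2 m', P m' & x = 'X_[m']) 'X_[m] ->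
  exists2 m', P m' & (m' <= m)%MM.
Proof.
move=> [s Ss sE].
have: ('X_[m] : {mpoly k[n]})@_m != 0 by rewrite mcoeffX eqxx oner_eq0.
rewrite sE raddf_sum /= => nz.
have [c sc nzc] : exists2 c, c \in s & (c.1 * c.2)@_m != 0.
  apply: NNPP => nc; move/eqP: nz; apply; rewrite big_seq big1 // => c sc.
  by apply: NNPP => nzc; apply: nc; exists c => //; apply/eqP.
have [m' Pm' c2E] := Ss c sc; exists m' => //.
move: nzc; rewrite c2E -mcoeff_msupp (perm_mem (msuppMX _ _)).
by case/mapP => m1 _ ->; apply: lem_addr.
Qed.

End MonomialIdeals.

(** * Filtration degrees and homogeneous classes in gr(A) *)

Section Filtration.

Context (k : fieldType) (A : algType k) (F : filtration A).
Implicit Types (a b : A) (p q : nat).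

Lemma filtB p a b : a \in F p -> b \in F p -> a - b \in F p.
Proof. by move=> Fa Fb; rewrite filt_add ?filt_opp. Qed.

Lemma filtZ p (c : k) a : a \in F p -> c *: a \in F p.
Proof. by move=> Fa; rewrite -mulr_algl filt_mull. Qed.

Lemma filt_sum (T : eqType) (r : seq T) (P : pred T) (b : T -> A) p :
  (forall t, t \in r -> P t -> b t \in F p) -> \sum_(t <- r | P t) b t \in F p.
Proof.
move=> Fb; rewrite big_seq_cond; elim/big_ind: _ => [||t /andP[]].
- exact: filt_zero.
- exact: filt_add.
- exact: Fb.
Qed.

Lemma filt_le p q : (p <= q)%N -> {subset F q <= F p}.
Proof.
move=> /subnKC <-; elim: (q - p)%N => [|i IHi] a; first by rewrite addn0.
by rewrite addnS => /filtS; apply: IHi.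
Qed.

Lemma filt_nul p a : (pnul F <= p)%N -> a \in F p -> a = 0.
Proof. by move=> lep /(filt_le lep); apply: filt_pnul. Qed.

Lemma filt_fval a : a \in F (fval F a).
Proof.
rewrite /fval; elim/big_ind: _ => [|p q Fp Fq|i Fa //]; first exact: filt0.
by rewrite /maxn; case: ifP.
Qed.

Lemma fval_max p a : a != 0 -> a \in F p -> (p <= fval F a)%N.
Proof.
move=> nza Fa; have ltp : (p < pnul F)%N.
  by rewrite ltnNge; apply: contra nza => lep; apply/eqP/(filt_nul lep).
by rewrite /fval (leq_bigmax_cond (Ordinal ltp)).
Qed.

Lemma fval_eq p a : a \in F p -> a \notin F p.+1 -> fval F a = p.
Proof.
move=> Fa nFa; have nza : a != 0 by apply: contraNneq nFa => ->; exact: filt_zero.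
apply/eqP; rewrite eqn_leq fval_max // andbT leqNgt.
by apply: contra nFa => lt; apply: (filt_le lt); exact: filt_fval.
Qed.

Lemma rees_monomD p a b : a \in F p -> b \in F p ->
  rees_monom F p (a + b) = rees_monom F p a + rees_monom F p b.
Proof.
move=> Fa Fb; apply: val_inj; rewrite rmorphD /= [LHS]rees_monomE ?filt_add //.
rewrite polyCD mulrDl; symmetry.
by congr (_ + _); apply: rees_monomE.
Qed.

Lemma gr_classD p a b : a \in F p -> b \in F p ->
  gr_class F p (a + b) = gr_class F p a + gr_class F p b.
Proof. by move=> Fa Fb; rewrite /gr_class rees_monomD // gr_pi_add. Qed.

Lemma gr_class0 p : gr_class F p 0 = 0.
Proof. by apply/(gr_class_eq0 (filt_zero F p)); exact: filt_zero. Qed.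

Lemma gr_classN p a : a \in F p -> gr_class F p (- a) = - gr_class F p a.
Proof.
by move=> Fa; apply/eqP; rewrite -addr_eq0 -gr_classD ?filt_opp // addNr gr_class0.
Qed.

Lemma gr_classB_eq p a b : a \in F p -> b \in F p ->
  gr_class F p a = gr_class F p b <-> a - b \in F p.+1.
Proof.
move=> Fa Fb; rewrite -gr_class_eq0 ?filtB // gr_classD ?filt_opp // gr_classN //.
by split=> [->|/eqP]; rewrite ?subrr // subr_eq0 => /eqP.
Qed.

Lemma gr_classZ p c a : a \in F p -> gr_class F p (c *: a) = c *: gr_class F p a.
Proof.
move=> Fa; rewrite -[RHS]/(gr_mul _ _) -gr_pi_mul; congr (\pi_(gr F) _)%qT.
apply: val_inj; rewrite rmorphM /= [LHS]rees_monomE ?filtZ //.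
by rewrite rees_monomE // mulrA -polyCM mulr_algl.
Qed.

Lemma gr_class1 : gr_class F 0 1 = 1.
Proof.
congr (\pi_(gr F) _)%qT; apply: val_inj.
by rewrite rmorph1 [LHS]rees_monomE ?filt0 // mul1r.
Qed.

(** This expresses that gr(A) is a direct sum: lifted to the Rees algebra, the equation says that a
    difference lies in the kernel, and its coefficient in degree [p] is read off. *)
Lemma gr_class_component (T : Type) (r : seq T) (w : T -> nat) (b : T -> A) p a :
  (forall t, b t \in F (w t)) -> a \in F p ->
  gr_class F p a = \sum_(t <- r) gr_class F (w t) (b t) ->
  a - \sum_(t <- r | w t == p) b t \in F p.+1.
Proof.
move=> Fb Fa.
have -> : \sum_(t <- r) gr_class F (w t) (b t)
    = \pi_(gr F)%qT (\sum_(t <- r) rees_monom F (w t) (b t)).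
  elim: r => [|t r IHr]; last by rewrite !big_cons gr_pi_add IHr.
  by rewrite !big_nil; symmetry; exact: pi_zeror.
move=> /gr_piE /grkerP /(_ p).
have coefE q b' i : b' \in F q ->
    (val (rees_monom F q b'))`_i = if q == i then b' else 0.
  move=> Fb'; rewrite rees_monomE // coefCM coefXn eq_sym.
  by case: eqP => _; rewrite ?mulr1 ?mulr0.
rewrite rmorphB coefB coefE // eqxx raddf_sum coef_sum => Fa1.
suff -> : \sum_(t <- r | w t == p) b t
    = \sum_(t <- r) (val (rees_monom F (w t) (b t)))`_p by [].
by rewrite big_mkcond; apply: eq_bigr => t _; rewrite coefE.
Qed.

(** If [a] is nonzero and its filtration degree were not [p], the component of [pr F a] in that
    degree would vanish, putting [a] one step deeper. For [a = 0] every [p] is allowed; this covers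
    the variables that vanish in gr(A). *)
Lemma gr_homog_pr p a : gr_homog p (pr F a) -> a \in F p /\ gr_class F p a = pr F a.
Proof.
move=> [b Fb prE]; have [->|nza] := eqVneq a 0.
  by rewrite filt_zero /pr !gr_class0.
have [<-|neq] := eqVneq (fval F a) p; first by rewrite filt_fval.
have := @gr_class_component unit [:: tt] (fun=> p) (fun=> b) _ _ (fun=> Fb)
  (filt_fval a).
rewrite big_seq1 => /(_ prE); rewrite big_cons big_nil eq_sym (negPf neq) subr0.
by move/(fval_max nza); rewrite ltnn.
Qed.

End Filtration.

(** * Lifts of monomials to A *)

Section LiftedMonomials.

Context (k : fieldType) (A : algType k) (F : filtration A).
Context (n : nat) (d : 'I_n -> nat) (phi : {lrmorphism {mpoly k[n]} -> gr F}).
Context (phi_homog : forall i, gr_homog (d i) (phi 'X_i)).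
Context (X : 'I_n -> A) (X_lift : forall i, pr F (X i) = phi 'X_i).
Implicit Types (M N : 'X_{1..n}) (f : {mpoly k[n]}).

Let lifts (a : A) (p : nat) f := a \in F p /\ gr_class F p a = phi f.

Let liftsM a b p q f g : lifts a p f -> lifts b q g -> lifts (a * b) (p + q) (f * g).
Proof.
by move=> [Fa aE] [Fb bE]; split; rewrite ?filt_mul // -gr_classM // aE bE rmorphM.
Qed.

Let lifts1 : lifts 1 0 1.
Proof. by split; rewrite ?filt0 // gr_class1 rmorph1. Qed.

Let lifts_tmonom M : lifts (tmonom X M) (wdeg d M) 'X_[M].
Proof.
rewrite mpolyXE_id /tmonom /wdeg; elim/big_ind3: _ => [|a p f b q g|i _].
- exact: lifts1.
- exact: liftsM.
have Xi : lifts (X i) (d i) 'X_i.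
  by rewrite /lifts -X_lift; apply: gr_homog_pr; rewrite X_lift.
elim: (M i) => [|e IHe]; first by rewrite muln0 !expr0; exact: lifts1.
by rewrite mulnS !exprS; apply: liftsM.
Qed.

Lemma tmonom_filt M : tmonom X M \in F (wdeg d M).
Proof. by case: (lifts_tmonom M). Qed.

Lemma gr_class_tmonom M : gr_class F (wdeg d M) (tmonom X M) = phi 'X_[M].
Proof. by case: (lifts_tmonom M). Qed.

(** Both terms have the class of the product monomial under [phi], whose source is commutative;
    reordering the factors therefore only costs an element of higher filtration degree. *)
Lemma tmonomM M N :
  tmonom X M * tmonom X N - tmonom X (M + N) \in F (wdeg d (M + N)).+1.
Proof.
have [Fab abE] := liftsM (lifts_tmonom M) (lifts_tmonom N).
rewrite -wdegD in Fab abE.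
by apply/gr_classB_eq => //; rewrite ?tmonom_filt // abE gr_class_tmonom mpolyXD.
Qed.

Lemma phi_wdeg_nul M : (pnul F <= wdeg d M)%N -> phi 'X_[M] = 0.
Proof.
move=> leM; rewrite -gr_class_tmonom (filt_nul leM (tmonom_filt M)).
exact: gr_class0.
Qed.

(** The polynomial [f] may be inhomogeneous: its components of other weights do not contribute in
    degree [p]. *)
Lemma gr_class_tcomb f p a : a \in F p -> gr_class F p a = phi f ->
  a - \sum_(m <- msupp f | wdeg d m == p) f@_m *: tmonom X m \in F p.+1.
Proof.
move=> Fa aE; apply: gr_class_component => // [m|].
  by rewrite filtZ ?tmonom_filt.
rewrite aE {1}[f]mpolyE raddf_sum; apply: eq_bigr => m _ /=.
by rewrite linearZ /= gr_classZ ?tmonom_filt // gr_class_tmonom.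
Qed.

End LiftedMonomials.

(** * Polynomials supported in a given set of monomials *)

Section Support.

Context (k : fieldType) (n : nat).
Implicit Types (f g : {mpoly k[n]}) (P Q : pred 'X_{1..n}).

Definition supp_in P f : bool := all P (msupp f).

Lemma supp_inP P f : reflect (forall m, f@_m != 0 -> P m) (supp_in P f).
Proof.
by apply: (iffP allP) => Pf m; [rewrite -mcoeff_msupp|rewrite mcoeff_msupp]; apply: Pf.
Qed.

Lemma supp_in_sub P Q f : (forall m, P m -> Q m) -> supp_in P f -> supp_in Q f.
Proof. by move=> sPQ; apply: sub_all. Qed.

Lemma supp_in0 P : supp_in P 0.
Proof. by apply/supp_inP => m; rewrite mcoeff0 eqxx. Qed.

Lemma supp_inD P f g : supp_in P f -> supp_in P g -> supp_in P (f + g).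
Proof.
move=> /supp_inP Pf /supp_inP Pg; apply/supp_inP => m; rewrite mcoeffD => nz.
have [f0|/Pf //] := eqVneq f@_m 0.
by apply: Pg; apply: contraNneq nz => g0; rewrite f0 g0 addr0.
Qed.

Lemma supp_inZ P c f : supp_in P f -> supp_in P (c *: f).
Proof.
move=> /supp_inP Pf; apply/supp_inP => m; rewrite mcoeffZ => nz.
by apply: Pf; apply: contraNneq nz => ->; rewrite mulr0.
Qed.

Lemma supp_inX P m : P m -> supp_in P ('X_[m] : {mpoly k[n]}).
Proof. by rewrite /supp_in msuppX /= andbT. Qed.

Definition wpart (d : 'I_n -> nat) (p : nat) f : {mpoly k[n]} :=
  \sum_(m <- msupp f | wdeg d m == p) f@_m *: 'X_[m].

Lemma mcoeff_wpart d p f m :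
  (wpart d p f)@_m = if wdeg d m == p then f@_m else 0.
Proof.
rewrite /wpart raddf_sum /=.
under eq_bigr => m' _ do rewrite mcoeffZ mcoeffX.
have [sm|/memN_msupp_eq0 fm0] := boolP (m \in msupp f); last first.
  rewrite fm0 if_same; apply: big1 => m' _.
  by case: eqP => [->|_]; rewrite ?fm0 ?mul0r ?mulr0.
rewrite big_mkcond (bigD1_seq m) //= eqxx mulr1 big1 ?addr0 // => m' /negPf ->.
by rewrite mulr0 if_same.
Qed.

Lemma supp_in_wpart P d p f : supp_in P f ->
  supp_in (fun m => P m && (wdeg d m == p)) (wpart d p f).
Proof.
move=> /supp_inP Pf; apply/supp_inP => m; rewrite mcoeff_wpart.
by case: ifP => [wm /Pf Pm|]; rewrite ?eqxx //= Pm.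
Qed.

End Support.

(** * Standard monomials as bases of gr(A) and A; leading terms in A *)

Section StandardBasis.

Context (k : fieldType) (A : algType k) (F : filtration A).
Context (n : nat) (d : 'I_n -> nat) (phi : {lrmorphism {mpoly k[n]} -> gr F}).
Context (phi_surj : forall u : gr F, exists f, phi f = u).
Context (phi_homog : forall i, gr_homog (d i) (phi 'X_i)).
Context (le : rel 'X_{1..n}) (le_adm : degrev_admissible d le).
Context (G : seq {mpoly k[n]}) (G_groebner : groebner le (fun f => phi f = 0) G).
Context (X : 'I_n -> A) (X_lift : forall i, pr F (X i) = phi 'X_i).
Implicit Types (a b : A) (M N m : 'X_{1..n}) (f g : {mpoly k[n]}) (p q : nat).

Let std := standard le G.
Let lt := slt le.

Lemma standard_lem m m' : (m <= m')%MM -> std m' -> std m.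
Proof.
move=> lemm' /allP std_m'; apply/allP => g Gg.
by apply: contra (std_m' g Gg) => legm; exact: lepm_trans lemm'.
Qed.

Lemma phi_replace (Q : pred 'X_{1..n}) f :
  (forall m, m \in msupp f ->
     exists2 g, supp_in Q g & phi g = phi 'X_[m]) ->
  exists2 g, supp_in Q g & phi g = phi f.
Proof.
rewrite {2}[f]mpolyE; elim: (msupp f) => [|m s IHs] Qs.
  by exists 0; rewrite ?supp_in0 ?big_nil.
have [|g Qg gE] := IHs; first by move=> m' sm'; apply: Qs; rewrite inE sm' orbT.
have [h Qh hE] := Qs m (mem_head _ _).
exists (f@_m *: h + g); first by rewrite supp_inD ?supp_inZ.
by rewrite big_cons !linearD !linearZ /= gE hE.
Qed.

(** Division by [G]: a multiple of some [g] cancels a nonstandard [M] and leaves smaller monomials,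
    to which induction applies. The strict bound for nonstandard [M] is what the descent later
    needs. *)
Lemma standard_reduceX M : exists2 f,
  supp_in (fun m => std m && (if std M then le m M else lt m M)) f
  & phi f = phi 'X_[M].
Proof.
elim/(well_founded_ind (slt_wf le_adm (pnul F))): M => M IHM.
have [stdM|nstdM] := boolP (std M).
  by exists 'X_[M]; rewrite ?supp_inX // stdM; exact: (dra_refl le_adm).
have /allPn[g Gg /negPn legM] := nstdM.
have [G0 GI _] := G_groebner.
have nzg : g != 0 by apply: contraNneq G0 => <-.
have phig : phi g = 0 by apply/GI; exact: ideal_span_mem.
pose L := (M - LM le g)%MM; have LE : (L + LM le g)%MM = M by rewrite submK.
pose r : {mpoly k[n]} := 'X_[M] - (LC le g)^-1 *: (g * 'X_[L]).
have -> : phi 'X_[M] = phi r.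
  by rewrite linearB linearZ /= rmorphM /= phig mul0r scaler0 subr0.
apply: phi_replace => m; rewrite mcoeff_msupp => rm.
have [eqmM|neqmM] := eqVneq m M.
  case/eqP: rm; rewrite eqmM mcoeffB mcoeffX eqxx mcoeffZ -[X in _@_X]LE.
  rewrite mcoeffMX.
  by rewrite mulVf ?subrr ?(LC_neq0 le_adm).
have ltmM : lt m M.
  rewrite /lt /slt neqmM andbT.
  move: rm; rewrite mcoeffB mcoeffX [M == m]eq_sym (negPf neqmM) sub0r oppr_eq0.
  rewrite mcoeffZ mulf_eq0 negb_or -mcoeff_msupp
 (perm_mem (msuppMX _ _)) => /andP[_].
  case/mapP => m' gm' ->; rewrite -LE (le_add2l le_adm).
  by have [_] := LM_spec le_adm nzg; apply.
(* Monomials of weight at least [pnul F] are zero in gr(A) and are dropped; the induction only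
   reaches the others. *)
have [lem|ltm] := leqP (pnul F) (wdeg d m).
  by exists 0; rewrite ?supp_in0 // raddf0 (phi_wdeg_nul phi_homog X_lift).
have [f Qf fE] := IHM m (conj ltmM ltm); exists f => //.
apply: supp_in_sub Qf => m' /andP[-> lem'] /=.
apply: (le_slt_trans le_adm) ltmM.
by move: lem'; case: ifP => // _ /sltW.
Qed.

Lemma standard_reduce f : exists2 g, supp_in std g & phi g = phi f.
Proof.
apply: phi_replace => m _; have [g stdg gE] := standard_reduceX m.
by exists g => //; apply: supp_in_sub stdg => m' /andP[].
Qed.

(** A nonzero element of the kernel has a leading monomial divisible by some [LM le g], which is
    then not standard. *)
Lemma standard_phi_eq0 f : supp_in std f -> phi f = 0 -> f = 0.
Proof.
move=> /allP stdf phif; apply/eqP; apply/negPn/negP => nzf.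
have [G0 _ GLM] := G_groebner.
have [fLM _] := LM_spec le_adm nzf.
have: ideal_span (fun x : {mpoly k[n]} =>
    exists2 m', (exists2 g, g \in G & m' = LM le g) & x = 'X_[m']) 'X_[LM le f].
  apply: (ideal_span_sub (S := fun x => exists2 g, g \in G & x = 'X_[LM le g])).
    by move=> y [g Gg ->]; apply: ideal_span_mem; exists (LM le g) => //; exists g.
  by apply/GLM/ideal_span_mem; exists f.
case/ideal_span_monomial => _ [g Gg ->] legf.
by have /allP/(_ g Gg)/negP := stdf _ fLM.
Qed.

Lemma tcomb_linear c f g : tcomb X (c *: f + g) = c *: tcomb X f + tcomb X g.
Proof.
have tcombE h s : uniq s -> {subset msupp h <= s} ->
    tcomb X h = \sum_(m <- s) h@_m *: tmonom X m.
  move=> us hs; rewrite [RHS](bigID (mem (msupp h))) /= [X in _ + X]big1 ?addr0.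
    rewrite -big_filter; apply: perm_big; apply: uniq_perm => [||m].
    - exact: msupp_uniq.
    - exact: filter_uniq.
    - by rewrite mem_filter andb_idr //; exact: hs.
  by move=> m /memN_msupp_eq0 ->; rewrite scale0r.
(* Cancellation may shrink the support of the sum, so all three sums are taken over one common
   list. *)
pose s := undup (msupp (c *: f + g) ++ msupp f ++ msupp g).
have us : uniq s by exact: undup_uniq.
rewrite !(tcombE _ s us); first last.
- by move=> m fm; rewrite mem_undup !mem_cat fm.
- by move=> m fm; rewrite mem_undup !mem_cat fm orbT.
- by move=> m fm; rewrite mem_undup !mem_cat fm !orbT.
rewrite scaler_sumr -big_split; apply: eq_bigr => m _ /=.
by rewrite mcoeffD mcoeffZ scalerDl scalerA.
Qed.

Lemma tcomb0 : tcomb X 0 = 0.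
Proof. by rewrite /tcomb msupp0 big_nil. Qed.

Lemma tcombD f g : tcomb X (f + g) = tcomb X f + tcomb X g.
Proof. by rewrite -[f]scale1r tcomb_linear !scale1r. Qed.

Lemma tcombZ c f : tcomb X (c *: f) = c *: tcomb X f.
Proof. by rewrite -[c *: f]addr0 tcomb_linear tcomb0 addr0. Qed.

Lemma tcombX m : tcomb X 'X_[m] = tmonom X m.
Proof. by rewrite /tcomb msuppX big_seq1 mcoeffX eqxx scale1r. Qed.

Lemma tcomb_wpart p f :
  tcomb X (wpart d p f) = \sum_(m <- msupp f | wdeg d m == p) f@_m *: tmonom X m.
Proof.
rewrite /wpart; elim/big_rec2: _ => [|m a g _ <-]; first exact: tcomb0.
by rewrite tcomb_linear tcombX.
Qed.

Lemma tcomb_filt p f : supp_in (fun m => p <= wdeg d m)%N f -> tcomb X f \in F p.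
Proof.
move=> /allP pf; apply: filt_sum => m fm _; apply/filtZ/(filt_le (pf m fm)).
exact: (tmonom_filt phi_homog X_lift).
Qed.

Lemma gr_class_homog p f : supp_in (fun m => wdeg d m == p) f ->
  gr_class F p (tcomb X f) = phi f.
Proof.
move=> /allP pf; rewrite {2}[f]mpolyE /tcomb.
suff [] : \sum_(m <- msupp f) f@_m *: tmonom X m \in F p /\
  gr_class F p (\sum_(m <- msupp f) f@_m *: tmonom X m)
    = phi (\sum_(m <- msupp f) f@_m *: 'X_[m]) by [].
rewrite big_seq [X in phi X]big_seq.
elim/big_rec2: _ => [|m g a /pf /eqP wm [Fa aE]].
  by rewrite filt_zero gr_class0 raddf0.
have Fm : tmonom X m \in F p by rewrite -wm (tmonom_filt phi_homog X_lift).
rewrite filt_add ?filtZ // gr_classD ?filtZ // gr_classZ // aE linearD linearZ /=.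
by rewrite -(gr_class_tmonom phi_homog X_lift) wm.
Qed.

(** Descending induction on [p], starting from [pnul F]: a standard combination of weight [p]
    represents the class of [a], and the remainder lies in the next step of the filtration. *)
Lemma filt_span p a : a \in F p -> exists2 f,
  supp_in (fun m => std m && (p <= wdeg d m)%N) f & tcomb X f = a.
Proof.
have [e] := ubnP (pnul F - p); elim: e p a => // e IHe p a lte Fa.
have [lep|ltp] := leqP (pnul F) p.
  by exists 0; rewrite ?supp_in0 // (filt_nul lep Fa) tcomb0.
have [f0 f0E] := phi_surj (gr_class F p a).
have [f stdf fE] := standard_reduce f0.
have Fa1 : a - tcomb X (wpart d p f) \in F p.+1.
  rewrite tcomb_wpart; apply: (gr_class_tcomb phi_homog X_lift Fa).
  by rewrite fE f0E.
have [|g stdg gE] := IHe p.+1 _ _ Fa1.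
  by rewrite subnS -ltnS (leq_trans _ lte) // prednK // subn_gt0.
exists (wpart d p f + g); last by rewrite tcombD gE addrC subrK.
apply: supp_inD; last by apply: supp_in_sub stdg => m /andP[-> /ltnW].
by apply: supp_in_sub (supp_in_wpart d p stdf) => m /andP[-> /eqP ->] /=.
Qed.

Lemma standard_span a : exists2 f, supp_in std f & tcomb X f = a.
Proof.
have [f stdf fE] := filt_span (filt0 F a).
by exists f => //; apply: supp_in_sub stdf => m /andP[].
Qed.

Lemma supp_in_LM f : f != 0 ->
  supp_in (fun m => wdeg d (LM le f) <= wdeg d m)%N f.
Proof.
move=> nzf; apply/allP => m fm; apply: (le_wdeg le_adm).
by have [_] := LM_spec le_adm nzf; apply.
Qed.

(* By (iii), the initial form of a standard combination is the part of the
   weight of its leading monomial. *)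
Lemma tcomb_initial f : f != 0 -> supp_in std f ->
  let p := wdeg d (LM le f) in
  [/\ tcomb X f \in F p, tcomb X f \notin F p.+1
    & gr_class F p (tcomb X f) = phi (wpart d p f)].
Proof.
move=> nzf stdf p.
have pE g : supp_in (fun m => wdeg d m == p) g -> tcomb X g \in F p.
  by move=> pg; apply: tcomb_filt; apply: supp_in_sub pg => m /eqP ->.
have wE := supp_in_wpart d p stdf.
have wp : supp_in (fun m => wdeg d m == p) (wpart d p f).
  by apply: supp_in_sub wE => m /andP[].
have Fp : tcomb X f \in F p by apply/tcomb_filt/supp_in_LM.
have Fp1 : tcomb X f - tcomb X (wpart d p f) \in F p.+1.
  rewrite -[X in _ - X]scale1r -scaleNr -tcombZ -tcombD; apply: tcomb_filt.
  apply/supp_inP => m; rewrite mcoeffD mcoeffZ mulN1r mcoeff_wpart.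
  have [_|neqmp] := eqVneq (wdeg d m) p; first by rewrite subrr eqxx.
  rewrite subr0 => fm; rewrite ltn_neqAle eq_sym neqmp /=.
  by apply: (supp_inP _ _ (supp_in_LM nzf)).
have clE : gr_class F p (tcomb X f) = phi (wpart d p f).
  by rewrite -(gr_class_homog wp); apply/(gr_classB_eq Fp (pE _ wp)).
split=> //; apply/negP => /(gr_class_eq0 Fp); rewrite clE => /standard_phi_eq0 w0.
have [fLM _] := LM_spec le_adm nzf; move: fLM; rewrite mcoeff_msupp.
have := mcoeff_wpart d p f (LM le f); rewrite eqxx => <-.
by rewrite w0 ?mcoeff0 ?eqxx //; apply: supp_in_sub wE => m /andP[].
Qed.

Lemma standard_tcomb_eq0 f : supp_in std f -> tcomb X f = 0 -> f = 0.
Proof.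
move=> stdf f0; apply/eqP/negPn/negP => nzf.
by have [_ /negP] := tcomb_initial nzf stdf; rewrite f0 filt_zero.
Qed.

Lemma coordsP (V : Type) (ev : {mpoly k[n]} -> V) v :
  (exists2 f, supp_in std f & ev f = v) ->
  supp_in std (coords le G ev v) /\ ev (coords le G ev v) = v.
Proof.
move=> [f stdf fE].
apply: (epsilon_spec _ (fun f => all std (msupp f) /\ ev f = v)).
by exists f.
Qed.

Lemma coords_grE f : supp_in std f -> coords_gr phi le G (phi f) = f.
Proof.
move=> stdf; have [|stdc cE] := @coordsP _ phi (phi f); first by exists f.
apply/eqP; rewrite -subr_eq0; apply/eqP/standard_phi_eq0.
  by rewrite -scaleN1r supp_inD ?supp_inZ.
by rewrite raddfB; apply/eqP; rewrite subr_eq0; apply/eqP.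
Qed.

Local Notation cA := (coordsA le G X).
Local Notation LMB := (LM_B le G X).

Lemma coordsA_std a : supp_in std (cA a).
Proof. by have [] := @coordsP _ (tcomb X) a (standard_span a). Qed.

Lemma coordsAK a : tcomb X (cA a) = a.
Proof. by have [] := @coordsP _ (tcomb X) a (standard_span a). Qed.

Lemma coordsA_tcomb f : supp_in std f -> cA (tcomb X f) = f.
Proof.
move=> stdf; apply/eqP; rewrite -subr_eq0; apply/eqP/standard_tcomb_eq0.
  by rewrite -scaleN1r supp_inD ?supp_inZ ?coordsA_std.
by rewrite -scaleN1r tcombD tcombZ coordsAK scaleN1r subrr.
Qed.

Lemma coordsA_linear c a b : cA (c *: a + b) = c *: cA a + cA b.
Proof.
rewrite -{1}[a]coordsAK -{1}[b]coordsAK -tcomb_linear coordsA_tcomb //.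
by rewrite supp_inD ?supp_inZ ?coordsA_std.
Qed.

Lemma coordsA0 : cA 0 = 0.
Proof. by rewrite -{1}tcomb0 coordsA_tcomb ?supp_in0. Qed.

Lemma coordsAD a b : cA (a + b) = cA a + cA b.
Proof. by rewrite -[a]scale1r coordsA_linear !scale1r. Qed.

Lemma coordsAZ c a : cA (c *: a) = c *: cA a.
Proof. by rewrite -[c *: a]addr0 coordsA_linear coordsA0 addr0. Qed.

Lemma coordsA_eq0 a : (cA a == 0) = (a == 0).
Proof.
apply/eqP/eqP => [a0|->]; last exact: coordsA0.
by rewrite -[a]coordsAK a0 tcomb0.
Qed.

Lemma coordsA_tmonom m : std m -> cA (tmonom X m) = 'X_[m].
Proof. by move=> stdm; rewrite -tcombX coordsA_tcomb // supp_inX. Qed.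

Lemma LM_B_std a : a != 0 -> std (LMB a).
Proof.
rewrite -coordsA_eq0 => /(LM_spec le_adm)[aLM _].
exact: (allP (coordsA_std a)).
Qed.

Lemma coordsA_LM_B a : a != 0 -> LMB a \in msupp (cA a).
Proof. by rewrite -coordsA_eq0 => /(LM_spec le_adm)[]. Qed.

Lemma LC_A_neq0 a : a != 0 -> LC_A le G X a != 0.
Proof. by rewrite -coordsA_eq0 => /(LC_neq0 le_adm). Qed.

(** The class [pr F a] comes from the part of lowest weight of the coordinates of [a], which
    contains the leading monomial by (iii). Hence the cofactors of step (2) can be computed from
    leading terms in A. *)
Lemma leading_pr a : a != 0 ->
  LM_gr phi le G (pr F a) = LMB a /\ LC_gr phi le G (pr F a) = LC_A le G X a.
Proof.
rewrite -coordsA_eq0 => nza; have [fLM maxLM] := LM_spec le_adm nza.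
have [] := tcomb_initial nza (coordsA_std a); rewrite coordsAK.
set p := wdeg d _ => Fa nFa aE.
have prE : pr F a = phi (wpart d p (cA a)) by rewrite /pr (fval_eq Fa nFa).
have cE : coords_gr phi le G (pr F a) = wpart d p (cA a).
  rewrite prE coords_grE //.
  by apply: supp_in_sub (supp_in_wpart d p (coordsA_std a)) => m /andP[].
have LME : LM le (wpart d p (cA a)) = LMB a.
  apply: (LM_max le_adm) => [|m]; rewrite mcoeff_msupp mcoeff_wpart ?eqxx.
    by rewrite -mcoeff_msupp.
  by case: ifP => _; rewrite ?eqxx // -mcoeff_msupp; exact: maxLM.
by rewrite /LM_gr /LC_gr /LC cE LME mcoeff_wpart eqxx.
Qed.

(** A bound on leading monomials, put on the whole support: it is stable under linear combinations
    and makes sense for [a = 0], where [LM_B] does not. *)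
Definition low (P : pred 'X_{1..n}) a : bool := supp_in P (cA a).

Lemma low_sub (P Q : pred 'X_{1..n}) a : (forall m, P m -> Q m) -> low P a -> low Q a.
Proof. exact: supp_in_sub. Qed.

Lemma low0 P : low P 0.
Proof. by rewrite /low coordsA0 supp_in0. Qed.

Lemma lowD P a b : low P a -> low P b -> low P (a + b).
Proof. by move=> Pa Pb; rewrite /low coordsAD supp_inD. Qed.

Lemma lowZ P c a : low P a -> low P (c *: a).
Proof. by move=> Pa; rewrite /low coordsAZ supp_inZ. Qed.

Lemma lowB P a b : low P a -> low P b -> low P (a - b).
Proof. by move=> Pa Pb; rewrite -scaleN1r lowD ?lowZ. Qed.

Lemma low_filt M a : a \in F (wdeg d M).+1 -> low (lt^~ M) a.
Proof.
move=> /filt_span[f stdf <-]; rewrite /low coordsA_tcomb.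
  by apply: supp_in_sub stdf => m /andP[_]; exact: (slt_wdeg le_adm).
by apply: supp_in_sub stdf => m /andP[].
Qed.

(** The part of weight |M| of the standard form of [M] in gr(A) approximates the lift of [M]; the
    error has higher filtration degree and so involves only monomials below [M]. *)
Lemma low_tmonom M : low (fun m => if std M then le m M else lt m M) (tmonom X M).
Proof.
have [f stdf fE] := standard_reduceX M.
have stdw : supp_in std (wpart d (wdeg d M) f).
  by apply: supp_in_sub (supp_in_wpart d _ stdf) => m /andP[/andP[]].
have Fm := tmonom_filt phi_homog X_lift M.
have := gr_class_tcomb phi_homog X_lift (f := f) Fm.
rewrite (gr_class_tmonom phi_homog X_lift) => /(_ (esym fE)).
rewrite -tcomb_wpart -{2}[tmonom X M](subrK (tcomb X (wpart d (wdeg d M) f))).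
move=> /low_filt lowr; apply: lowD.
  by apply: low_sub lowr => m ltm; case: ifP => // _; apply: sltW.
rewrite /low coordsA_tcomb //.
by apply: supp_in_sub (supp_in_wpart d _ stdf) => m /andP[/andP[]].
Qed.

Lemma low_le_tmonom M : low (le^~ M) (tmonom X M).
Proof. by apply: low_sub (low_tmonom M) => m; case: ifP => // _ /sltW. Qed.

Lemma low_tmonomM M N :
  low (lt^~ (M + N)%MM) (tmonom X M * tmonom X N - tmonom X (M + N)).
Proof. exact/low_filt/(tmonomM phi_homog X_lift). Qed.

Lemma low_le_tmonomM M N : low (le^~ (M + N)%MM) (tmonom X M * tmonom X N).
Proof.
rewrite -[X in low _ X](subrK (tmonom X (M + N))) lowD ?low_le_tmonom //.
by apply: low_sub (low_tmonomM M N) => m /sltW.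
Qed.

Lemma low_mul (P Q : pred 'X_{1..n}) N a :
  (forall m m', P m -> le m' (N + m)%MM -> Q m') ->
  low P a -> low Q (tmonom X N * a).
Proof.
move=> PQ /allP Pa; rewrite -[a]coordsAK /tcomb mulr_sumr big_seq.
elim/big_ind: _ => [||m am]; [exact: low0 | exact: lowD |].
rewrite -scalerAr; apply: lowZ; apply: low_sub (low_le_tmonomM N m) => m' lem'.
by apply: PQ lem'; exact: Pa.
Qed.

Lemma low_lt_mul M N a : low (lt^~ M) a -> low (lt^~ (N + M)%MM) (tmonom X N * a).
Proof.
apply: low_mul => m m' ltmM lem'; apply: (le_slt_trans le_adm) lem' _.
by rewrite (slt_add2l le_adm).
Qed.

Lemma low_le_mul M N a : low (le^~ M) a -> low (le^~ (N + M)%MM) (tmonom X N * a).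
Proof.
apply: low_mul => m m' lemM lem'; apply: (dra_trans le_adm) lem' _.
by rewrite (le_add2l le_adm).
Qed.

Lemma low_LM_B a : low (le^~ (LMB a)) a.
Proof.
have [->|] := eqVneq a 0; first exact: low0.
by rewrite -coordsA_eq0 => /(LM_spec le_adm)[_ maxLM]; apply/allP.
Qed.

Lemma low_lt_coef M a : low (lt^~ M) a -> (cA a)@_M = 0.
Proof.
move=> /allP lta; apply: memN_msupp_eq0; apply/negP => /lta.
by rewrite /lt /slt eqxx andbF.
Qed.

Lemma low_le_lt M a : low (le^~ M) a -> (cA a)@_M = 0 -> low (lt^~ M) a.
Proof.
move=> /supp_inP lea aM; apply/supp_inP => m am; rewrite /lt /slt lea //.
by apply: contraNneq am => ->; rewrite aM.
Qed.

(** Multiplicativity of leading terms, as long as the product of the leading monomials is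
    standard. *)
Lemma coef_LM_mul a N : std (N + LMB a)%MM ->
  (cA (tmonom X N * a))@_(N + LMB a)%MM = LC_A le G X a.
Proof.
move=> stdNM; have stdM : std (LMB a) by apply: standard_lem stdNM; exact: lem_addl.
pose c := LC_A le G X a; pose b := a - c *: tmonom X (LMB a).
have ltb : low (lt^~ (LMB a)) b.
  apply: low_le_lt; first by rewrite lowB ?lowZ ?low_LM_B ?low_le_tmonom.
  rewrite /b -scaleNr coordsAD coordsAZ coordsA_tmonom // mcoeffD mcoeffZ mcoeffX.
  by rewrite eqxx mulr1 subrr.
(* Of the three summands, the product with the tail [b] and the error of multiplying two lifts stay
   strictly below [N + LMB a]; only the last contributes there. *)
have -> : tmonom X N * a = tmonom X N * b
    + c *: (tmonom X N * tmonom X (LMB a) - tmonom X (N + LMB a))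
    + c *: tmonom X (N + LMB a).
  by rewrite -addrA -scalerDr subrK scalerAr -mulrDr subrK.
rewrite !coordsAD !mcoeffD (low_lt_coef (low_lt_mul N ltb)) add0r.
rewrite !coordsAZ !mcoeffZ (low_lt_coef (low_tmonomM _ _)) mulr0 add0r.
by rewrite coordsA_tmonom // mcoeffX eqxx mulr1.
Qed.

End StandardBasis.

(** * Linear spans over k *)

Section LinearSpan.

Context (k : fieldType) (A : algType k).
Implicit Types (S T : A -> Prop) (a x y : A).

(** Only scalars serve as coefficients, unlike in [ideal_span], so a bound on each generator is
    kept; the inductive form allows induction on the length of an expression. *)
Inductive lspan S : A -> Prop :=
| lspan0 : lspan S 0
| lspan_cons c x y of S x & lspan S y : lspan S (c *: x + y).

Lemma lspanD S x y : lspan S x -> lspan S y -> lspan S (x + y).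
Proof.
by elim=> [|c x' z Sx' _ IHz] Sy; rewrite ?add0r // -addrA; apply/lspan_cons/IHz.
Qed.

Lemma lspanZ S c x : lspan S x -> lspan S (c *: x).
Proof.
elim=> [|c' x' z Sx' _ IHz]; first by rewrite scaler0; apply: lspan0.
by rewrite scalerDr scalerA; apply: lspan_cons.
Qed.

Lemma lspanB S x y : lspan S x -> lspan S y -> lspan S (x - y).
Proof. by move=> Sx Sy; rewrite -scaleN1r; apply/lspanD/lspanZ. Qed.

Lemma lspan_mem S x : S x -> lspan S x.
Proof. by move=> Sx; rewrite -[x]addr0 -[x]scale1r; apply/lspan_cons/lspan0. Qed.

Lemma lspan_mul S T a x :
  (forall y, S y -> lspan T (a * y)) -> lspan S x -> lspan T (a * x).
Proof.
move=> sST; elim=> [|c y z Sy _ IHz]; first by rewrite mulr0; apply: lspan0.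
by rewrite mulrDr -scalerAr; apply/lspanD/IHz/lspanZ/sST.
Qed.

Lemma lspan_sub S T x : (forall y, S y -> T y) -> lspan S x -> lspan T x.
Proof.
by move=> sST; elim=> [|c y z /sST Ty _]; [apply: lspan0 | apply: lspan_cons].
Qed.

End LinearSpan.

(** * Buchberger's criterion and termination *)

Section Buchberger.

Context (k : fieldType) (A : algType k) (F : filtration A).
Context (n : nat) (d : 'I_n -> nat) (phi : {lrmorphism {mpoly k[n]} -> gr F}).
Context (phi_surj : forall u : gr F, exists f, phi f = u).
Context (phi_homog : forall i, gr_homog (d i) (phi 'X_i)).
Context (le : rel 'X_{1..n}) (le_adm : degrev_admissible d le).
Context (G : seq {mpoly k[n]}) (G_groebner : groebner le (fun f => phi f = 0) G).
Context (X : 'I_n -> A) (X_lift : forall i, pr F (X i) = phi 'X_i).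
Implicit Types (a b h x : A) (H : seq A) (P Q : pred 'X_{1..n}).
Implicit Types (L M N m q : 'X_{1..n}) (f g : {mpoly k[n]}).

Local Notation std := (standard le G).
Local Notation lt := (slt le).
Local Notation cA := (coordsA le G X).
Local Notation LMB := (LM_B le G X).
Local Notation LCA := (LC_A le G X).
Local Notation low := (low le G X).
Local Notation tmon := (tmonom X).

Let low0 := low0 phi_surj phi_homog le_adm G_groebner X_lift.
Let lowD := lowD phi_surj phi_homog le_adm G_groebner X_lift.
Let lowZ := lowZ phi_surj phi_homog le_adm G_groebner X_lift.
Let lowB := lowB phi_surj phi_homog le_adm G_groebner X_lift.
Let low_LM_B := low_LM_B phi_surj phi_homog le_adm G_groebner X_lift.
Let low_le_mul := low_le_mul phi_surj phi_homog le_adm G_groebner X_lift.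
Let low_le_tmonomM := low_le_tmonomM phi_surj phi_homog le_adm G_groebner X_lift.
Let low_tmonomM := low_tmonomM phi_surj phi_homog le_adm G_groebner X_lift.
Let coef_LM_mul := coef_LM_mul phi_surj phi_homog le_adm G_groebner X_lift.
Let coordsAD := coordsAD phi_surj phi_homog le_adm G_groebner X_lift.
Let coordsAZ := coordsAZ phi_surj phi_homog le_adm G_groebner X_lift.
Let coordsA_std := coordsA_std phi_surj phi_homog le_adm G_groebner X_lift.
Let coordsAK := coordsAK phi_surj phi_homog le_adm G_groebner X_lift.
Let LC_A_neq0 := LC_A_neq0 phi_surj phi_homog le_adm G_groebner X_lift.
Let LM_B_std := LM_B_std phi_surj phi_homog le_adm G_groebner X_lift.
Let coordsA_LM_B := coordsA_LM_B phi_surj phi_homog le_adm G_groebner X_lift.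
Let leading_pr := leading_pr phi_surj phi_homog le_adm G_groebner X_lift.

Definition downward P := forall m m', le m' m -> P m -> P m'.

Lemma downward_lt M : downward (lt^~ M).
Proof. by move=> m m' /(le_slt_trans le_adm); apply. Qed.

Lemma downward_le M : downward (le^~ M).
Proof. by move=> m m' lem' lem; exact: (dra_trans le_adm) lem' lem. Qed.

(** Monomials of weight at least [pnul F] vanish in gr(A), standard ones do not. This bound makes
    [slt_wf] applicable to monomials occurring in elements of A. *)
Lemma std_wdeg m : std m -> (wdeg d m < pnul F)%N.
Proof.
move=> stdm; rewrite ltnNge; apply/negP => lem.
have Xm : supp_in std ('X_[m] : {mpoly k[n]}) by exact: supp_inX.
have := standard_phi_eq0 le_adm G_groebner Xm.
rewrite (phi_wdeg_nul phi_homog X_lift lem) => /(_ erefl) /mpolyP/(_ m).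
by rewrite mcoeffX eqxx mcoeff0 => /eqP; rewrite oner_eq0.
Qed.

(* hspan H P is the span of the products of elements of H by monomials whose
   formal leading monomial, possibly not in B, satisfies P. *)
Definition hspan H P : A -> Prop :=
  lspan (fun x => exists q h, [/\ h \in H, P (q + LMB h)%MM & x = tmon q * h]).

Lemma hspan_sub H P Q x : (forall m, P m -> Q m) -> hspan H P x -> hspan H Q x.
Proof.
by move=> sPQ; apply: lspan_sub => y [q [h [Hh /sPQ Qqh ->]]]; exists q, h.
Qed.

Lemma hspan_low H P x : downward P -> hspan H P x -> low P x.
Proof.
move=> downP; elim=> [|c y z [q [h [Hh Pqh ->]]] _ lowz]; first exact: low0.
rewrite lowD ?lowZ //; apply: low_sub (low_le_mul q (low_LM_B h)) => m lem.
exact: downP lem Pqh.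
Qed.

Lemma hspan_mull H P h a :
  h \in H -> low (fun m => P (m + LMB h)%MM) a -> hspan H P (a * h).
Proof.
move=> Hh /allP Pa; rewrite -[a]coordsAK /tcomb mulr_suml big_seq.
elim/big_ind: _ => [||m am]; [exact: lspan0 | exact: lspanD |].
by rewrite -scalerAl; apply/lspanZ/lspan_mem; exists m, h; split=> //; apply: Pa.
Qed.

Lemma hspan_mul H N L x : hspan H (lt^~ L) x -> hspan H (lt^~ (N + L)%MM) (tmon N * x).
Proof.
apply: lspan_mul => _ [q [h [Hh ltqh ->]]]; rewrite mulrA.
apply: (hspan_mull (P := lt^~ (N + L)%MM)) => //.
apply: low_sub (low_le_tmonomM N q) => m lem.
apply: (le_slt_trans le_adm (N := (N + q + LMB h)%MM)).
  by rewrite (le_add2r le_adm).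
by rewrite -addmA (slt_add2l le_adm).
Qed.

(** Merging two monomial factors into one changes the product only by terms with smaller formal
    leading monomials. *)
Lemma hspan_mul_tmonom H N q h : h \in H ->
  hspan H (lt^~ (N + (q + LMB h))%MM) (tmon N * (tmon q * h) - tmon (N + q) * h).
Proof.
move=> Hh; rewrite mulrA -mulrBl; apply: hspan_mull => //.
apply: low_sub (low_tmonomM N q) => m ltm.
by rewrite addmA (slt_add2r le_adm).
Qed.

(** * Reduction modulo [H] *)

Section Reduction.

Context (H : seq A) (H_neq0 : 0 \notin H).

Local Notation redm := (fun m => has (fun h => (LMB h <= m)%MM) H).
Local Notation red1 := (red1 le G X H).
Local Notation red := (red le G X H).
Local Notation reducible := (reducible le G X H).

Lemma H_mem_neq0 h : h \in H -> h != 0.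
Proof. by move=> Hh; apply: contraNneq H_neq0 => <-. Qed.

Lemma reducibleP a :
  reflect (exists2 m, m \in msupp (cA a) & redm m) (reducible a).
Proof.
rewrite /reducible /reducible_monoms -has_filter; apply: (iffP hasP) => -[m].
  by rewrite mem_monoms => am hm; exists m.
by move=> am hm; exists m; rewrite ?mem_monoms.
Qed.

Lemma red1_id a : ~~ reducible a -> red1 a = a.
Proof. by rewrite /Defs.red1 /Defs.reducible; case: reducible_monoms. Qed.

Lemma red1_spec a : reducible a -> exists m q h c,
  [/\ h \in H, m = (q + LMB h)%MM, m \in msupp (cA a),
      forall m', m' \in msupp (cA a) -> redm m' -> le m' m &
      red1 a = a - c *: (tmon q * h) /\ (cA (red1 a))@_m = 0].
Proof.
rewrite /Defs.reducible /Defs.red1.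
case rE: (reducible_monoms le G X H a) => [//|m s] _.
have [am redm_m maxm] := filter_monoms le_adm rE.
set h := nth 0 H _.
have Hh : h \in H by rewrite mem_nth // -has_find.
have lehm : (LMB h <= m)%MM by exact: (nth_find 0 redm_m).
have r1E : red1_by le G X a h = a - ((cA a)@_m / LCA h) *: (tmon (m - LMB h) * h).
  rewrite /red1_by; case fE: [seq _ <- _ | _] => [|m1 s1].
    have : m \in [seq m <- monoms le (cA a) | (LMB h <= m)%MM].
      by rewrite mem_filter lehm mem_monoms.
    by rewrite fE.
  have [am1 lehm1 maxm1] := filter_monoms le_adm fE.
  (* [red1_by] looks again for the largest monomial divisible by [LMB h]; it finds [m], the largest
     one reducible by any element of [H]. *)
  suff -> : m1 = m by [].
  apply: (dra_anti le_adm); rewrite (maxm1 m) // maxm //.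
  by apply/hasP; exists h.
have mE : (m - LMB h + LMB h)%MM = m by exact: submK.
exists m, (m - LMB h)%MM, h, ((cA a)@_m / LCA h); split=> //; split=> //.
rewrite r1E -scaleNr coordsAD coordsAZ mcoeffD mcoeffZ.
rewrite -{3}mE coef_LM_mul ?mE; last exact: (allP (coordsA_std a)).
by rewrite mulNr mulfVK ?subrr // LC_A_neq0 ?H_mem_neq0.
Qed.

(** The subtracted multiple of [h] only brings in monomials below the one treated, and that one is
    cancelled. *)
Lemma red1_decreases a m : reducible a ->
  (forall m', m' \in msupp (cA a) -> redm m' -> le m' m) ->
  forall m', m' \in msupp (cA (red1 a)) -> redm m' -> lt m' m.
Proof.
move=> /red1_spec[m0 [q [h [c [Hh m0E am0 maxm0 [r1E r10]]]]]] lem m' r1m' redm'.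
have lem0 : le m0 m.
  by apply: lem => //; apply/hasP; exists h => //; rewrite m0E lem_addl.
apply: (slt_le_trans le_adm) lem0; apply/andP; split; last first.
  by move: r1m'; rewrite mcoeff_msupp; apply: contraNneq => ->; rewrite r10.
have [am'|nam'] := boolP (m' \in msupp (cA a)); first exact: maxm0.
have /allP := low_le_mul q (low_LM_B h); rewrite -m0E; apply.
move: r1m'; rewrite !mcoeff_msupp r1E -scaleNr coordsAD coordsAZ mcoeffD mcoeffZ.
by rewrite (memN_msupp_eq0 nam') add0r; apply: contraNneq => ->; rewrite mulr0.
Qed.

(** Well-founded induction on the largest reducible monomial. It guarantees that the number of
    iterations chosen in [red] is a good one. *)
Lemma iter_red1_irreducible a : exists N : nat, ~~ reducible (iter N red1 a).
Proof.
suff bounded M b : (forall m, m \in msupp (cA b) -> redm m -> le m M) ->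
    exists N : nat, ~~ reducible (iter N red1 b).
  have [ra|ra] := boolP (reducible a); last by exists 0%N.
  have [m [q [h [c [_ _ _ maxm _]]]]] := red1_spec ra; exact: bounded maxm.
elim/(well_founded_ind (slt_wf le_adm (pnul F))): M b => M IHM b leM.
have [rb|rb] := boolP (reducible b); last by exists 0%N.
have [r1b|r1b] := boolP (reducible (red1 b)); last by exists 1%N.
have [m [q [h [c [Hh mE r1bm maxm _]]]]] := red1_spec r1b.
have ltmM : lt m M.
  apply: (red1_decreases rb leM r1bm); apply/hasP; exists h => //.
  by rewrite mE lem_addl.
have [|N irrN] := IHM m _ (red1 b) maxm.
  by split=> //; apply: std_wdeg; exact: (allP (coordsA_std (red1 b)) m r1bm).
by exists N.+1; rewrite iterSr.
Qed.

Lemma red_irreducible a : ~~ reducible (red a).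
Proof.
exact: (epsilon_spec _ (fun N : nat => ~~ reducible (iter N red1 a))
  (iter_red1_irreducible a)).
Qed.

(** Each reduction step subtracts a product whose formal leading monomial occurs in the current
    element. So an element with zero reduction is a combination respecting its own bound. *)
Lemma hspan_red P a : downward P -> low P a -> hspan H P (a - red a).
Proof.
(* The claim holds after any number of iterations, so the chosen one is forgotten. *)
move=> downP lowa; rewrite /Defs.red; set N := epsilon _ _; clearbody N.
suff [] : hspan H P (a - iter N red1 a) /\ low P (iter N red1 a) by [].
elim: N => [|N [VN lowN]]; first by rewrite subrr; split; [apply: lspan0 |].
rewrite iterS; set b := iter N red1 a in VN lowN *.
have [/red1_spec|/red1_id -> //] := boolP (reducible b).
move=> [m [q [h [c [Hh mE bm _ [-> _]]]]]].
have VPh : hspan H P (c *: (tmon q * h)).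
  apply/lspanZ/lspan_mem; exists q, h; split=> //; rewrite -mE.
  exact: (allP lowN).
split; last by rewrite lowB ?(hspan_low downP VPh).
by rewrite opprB addrA addrAC; apply: lspanD.
Qed.

Lemma red_LM a h : red a != 0 -> h \in H -> ~~ (LMB h <= LMB (red a))%MM.
Proof.
move=> nzr Hh; apply: contra (red_irreducible a) => leh; apply/reducibleP.
by exists (LMB (red a)); [exact: coordsA_LM_B | apply/hasP; exists h].
Qed.

Lemma red_mem (J : {pred A}) a :
  left_ideal J -> {subset H <= J} -> a \in J -> red a \in J.
Proof.
move=> [J0 JD JM] HJ Ja.
have VJ x : hspan H predT x -> x \in J.
  elim=> [//|c y z [q [h [Hh _ ->]]] _ Jz].
  by rewrite JD // -mulr_algl !JM ?HJ.
rewrite -[red a](subKr a) -mulN1r JD // JM // VJ //.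
by apply: hspan_red => //; apply/allP.
Qed.

(** * Saturated sets and the descent on formal leading monomials *)

Section Saturated.

Context (H_sat : saturated phi le G X H).

Lemma saturated_red_of_G h g : h \in H -> g \in G -> red_of_G phi le G X H h g = 0.
Proof.
move=> Hh Gg; apply/eqP/negPn/negP => nz.
exact: (H_sat (Step1 Hh Gg nz)).
Qed.

Lemma saturated_red_of_pair h1 h2 : h1 \in H -> h2 \in H ->
  red_of_pair phi le G X H h1 h2 = 0.
Proof.
move=> Hh1 Hh2; apply/eqP/negPn/negP => nz.
exact: (H_sat (Step2 Hh1 Hh2 nz)).
Qed.

Lemma tilde_std f : supp_in std f -> tilde phi le G X f = tcomb X f.
Proof. by move=> stdf; rewrite /tilde /tilde_gr (coords_grE le_adm G_groebner). Qed.

Lemma tilde_term c m : std m -> tilde phi le G X (c *: 'X_[m]) = c *: tmon m.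
Proof.
by move=> stdm; rewrite tilde_std ?supp_inZ ?supp_inX // tcombZ tcombX.
Qed.

(** If [q] is not standard, its lift already rewrites to smaller terms. Otherwise the product is, up
    to smaller terms, a multiple of one considered in step (1), whose reduction is zero by
    saturation. *)
Lemma hspan_nonstandard q h : h \in H -> ~~ std (q + LMB h)%MM ->
  hspan H (lt^~ (q + LMB h)%MM) (tmon q * h).
Proof.
move=> Hh nstdM; have [stdq|nstdq] := boolP (std q); last first.
  apply: hspan_mull => //.
  have := low_tmonom phi_surj phi_homog le_adm G_groebner X_lift q.
  by rewrite (negPf nstdq); apply: low_sub => m; rewrite (slt_add2r le_adm).
have /allPn[g Gg /negPn legM] := nstdM.
pose L := mlcm (LMB h) (LM le g); pose q0 := (L - LMB h)%MM.
have q0E : (q0 + LMB h)%MM = L by rewrite submK ?lem_mlcml.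
have leLM : (L <= q + LMB h)%MM by rewrite lem_mlcm lem_addl.
pose N := (q + LMB h - L)%MM.
have NE : (N + q0 = q)%MM by apply: (@addIm _ (LMB h)); rewrite -addmA q0E submK.
have stdq0 : std q0 by apply: standard_lem stdq; rewrite -NE lem_addl.
have nstdL : ~~ std L by apply/allPn; exists g => //; rewrite negbK lem_mlcmr.
(* The product is bounded by [L], which cannot occur in it, not being standard. *)
have lowL : low (lt^~ L) (tmon q0 * h).
  apply: low_le_lt; first by rewrite -{1}q0E low_le_mul ?low_LM_B.
  apply: memN_msupp_eq0; apply: contra nstdL; exact: (allP (coordsA_std _)).
have VL : hspan H (lt^~ L) (tmon q0 * h).
  have := hspan_red (@downward_lt L) lowL.
  have := saturated_red_of_G Hh Gg; rewrite /red_of_G.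
  by rewrite -[X in tilde _ _ _ _ X]scale1r tilde_term // scale1r => ->; rewrite subr0.
have := lspanB (hspan_mul N VL) _; rewrite -{1}NE.
have := @hspan_mul_tmonom H N q0 h Hh; rewrite q0E NE => VN.
by move=> /(_ _ VN); rewrite -{1}q0E addmA NE subKr.
Qed.

(** The difference is, up to smaller terms, a monomial multiple of the S-pair at the lcm [L]; there
    the leading terms cancel and the reduction is zero by saturation. *)
Lemma hspan_S_pair q1 q2 h1 h2 : h1 \in H -> h2 \in H ->
  (q1 + LMB h1 = q2 + LMB h2)%MM -> std (q1 + LMB h1)%MM ->
  hspan H (lt^~ (q1 + LMB h1)%MM)
    ((LCA h1)^-1 *: (tmon q1 * h1) - (LCA h2)^-1 *: (tmon q2 * h2)).
Proof.
set M := (q1 + LMB h1)%MM => Hh1 Hh2 ME stdM.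
pose L := mlcm (LMB h1) (LMB h2); pose N := (M - L)%MM.
have leLM : (L <= M)%MM by rewrite lem_mlcm lem_addl ME lem_addl.
have stdL : std L by exact: standard_lem stdM.
pose s q h := (LCA h)^-1 *: (tmon q * h).
(* Both members of the S-pair are treated alike: the cofactor normalizes the coefficient at [L] to
   1, and multiplication by [N] recovers the product at [M] up to smaller terms. *)
have term q h : h \in H -> (q + LMB h = M)%MM -> (LMB h <= L)%MM ->
    let t := (L - LMB h)%MM in
    [/\ tilde phi le G X (cofactor_of phi le G L h) * h = s t h,
        low (le^~ L) (s t h), (cA (s t h))@_L = 1
      & hspan H (lt^~ M) (tmon N * s t h - s q h)].
  move=> Hh qE lehL t; have tE : (t + LMB h)%MM = L by exact: submK.
  have NE : (N + t = q)%MM.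
    by apply: (@addIm _ (LMB h)); rewrite -addmA tE submK.
  have stdt : std t by apply: standard_lem stdL; rewrite -tE lem_addr.
  have nzh := H_mem_neq0 Hh; split.
  - have [LME LCE] := leading_pr nzh.
    by rewrite /cofactor_of LME LCE tilde_term // -scalerAl.
  - by rewrite lowZ // -{1}tE low_le_mul ?low_LM_B.
  - by rewrite coordsAZ mcoeffZ -{1}tE coef_LM_mul ?tE // mulVf ?LC_A_neq0.
  rewrite /s -scalerAr -scalerBr; apply: lspanZ.
  by have := @hspan_mul_tmonom H N t h Hh; rewrite addmA NE qE.
have [c1 low1 coef1 V1] := term q1 h1 Hh1 erefl (lem_mlcml _ _).
have [c2 low2 coef2 V2] := term q2 h2 Hh2 (esym ME) (lem_mlcmr _ _).
have lowL : low (lt^~ L) (s (L - LMB h1)%MM h1 - s (L - LMB h2)%MM h2).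
  apply: low_le_lt; first exact: lowB.
  rewrite -scaleN1r coordsAD [cA (-1 *: _)]coordsAZ mcoeffD mcoeffZ coef1 coef2.
  by rewrite mulr1 subrr.
have VL := hspan_red (@downward_lt L) lowL.
have := saturated_red_of_pair Hh1 Hh2; rewrite /red_of_pair c1 c2 => r0.
move: VL; rewrite r0 subr0 => /(hspan_mul N); rewrite submK // mulrBr => VM.
have := lspanD (lspanB VM V1) V2.
by rewrite opprB [X in lspan _ (X + _)]addrC !subrKA.
Qed.

(** All terms at [M] collapse to at most one: they are rewritten by [hspan_nonstandard] if [M] is
    not standard, and merged pairwise by [hspan_S_pair] if it is. *)
Lemma hspan_leading M a : hspan H (le^~ M) a -> hspan H (lt^~ M) a \/
  exists q h c, [/\ h \in H, (q + LMB h = M)%MM, std M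
    & hspan H (lt^~ M) (a - c *: (tmon q * h))].
Proof.
elim=> [|c _ y [q [h [Hh leqh ->]]] _ IHy]; first by left; apply: lspan0.
have [qhM|qhM] := eqVneq (q + LMB h)%MM M; last first.
  have Vqh : hspan H (lt^~ M) (c *: (tmon q * h)).
    by apply/lspanZ/lspan_mem; exists q, h; split=> //; apply/andP.
  case: IHy => [Vy|[q' [h' [c' [Hh' qhM' stdM Vy]]]]]; first by left; apply: lspanD.
  by right; exists q', h', c'; split=> //; rewrite -addrA; apply: lspanD.
have [stdM|nstdM] := boolP (std M); last first.
  have Vqh : hspan H (lt^~ M) (c *: (tmon q * h)).
    by rewrite -{1}qhM; apply/lspanZ/hspan_nonstandard; rewrite ?qhM.
  case: IHy => [Vy|[q' [h' [c' [Hh' qhM' stdM Vy]]]]]; first by left; apply: lspanD.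
  by rewrite stdM in nstdM.
right; case: IHy => [Vy|[q' [h' [c' [Hh' qhM' _ Vy]]]]].
  by exists q, h, c; split=> //; rewrite addrAC subrr add0r.
exists q', h', (c * LCA h / LCA h' + c'); split=> //.
have := @hspan_S_pair q q' h h' Hh Hh'; rewrite qhM qhM' => /(_ erefl stdM).
(* This multiple of the S-pair trades the new term in [h] for one in [h'], which joins the term
   already there. *)
move=> /(lspanZ (c * LCA h)) /lspanD /(_ Vy); congr (hspan _ _ _).
rewrite scalerBr !scalerA mulfK ?LC_A_neq0 ?H_mem_neq0 //.
by rewrite scalerDl opprD addrACA.
Qed.

Lemma hspan_bounded P a : hspan H P a -> a = 0 \/ exists2 M, P M & hspan H (le^~ M) a.
Proof.
elim=> [|c _ y [q [h [Hh Pqh ->]]] _ IHy]; first by left.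
have Vqh : hspan H (le^~ (q + LMB h)%MM) (c *: (tmon q * h)).
  by apply/lspanZ/lspan_mem; exists q, h; split=> //; exact: (dra_refl le_adm).
right; case: IHy => [->|[M PM Vy]].
  by exists (q + LMB h)%MM; rewrite ?addr0.
have /orP[leM|leM] := dra_total le_adm (q + LMB h)%MM M.
  exists M => //; apply: lspanD => //.
  by apply: (hspan_sub (Q := le^~ M)) Vqh => m lem; exact: (dra_trans le_adm) lem leM.
exists (q + LMB h)%MM => //; apply: lspanD => //.
apply: (hspan_sub (Q := le^~ (q + LMB h)%MM)) Vy => m lem.
exact: (dra_trans le_adm) lem leM.
Qed.

(** Induction on the formal bound [M]. Either the terms at [M] disappear and the bound drops, or a
    single nonzero one survives; smaller terms cannot cancel it, so [M] is the leading monomial of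
    [a]. *)
Lemma hspan_LM_dvd M a : a != 0 -> hspan H (le^~ M) a ->
  exists2 h, h \in H & (LMB h <= LMB a)%MM.
Proof.
elim/(well_founded_ind (slt_wf le_adm (pnul F))): M a => M IHM a nza VM.
have descend : hspan H (lt^~ M) a -> exists2 h, h \in H & (LMB h <= LMB a)%MM.
  move=> /hspan_bounded[a0|[M' ltM' VM']]; first by rewrite a0 eqxx in nza.
  apply: (IHM M') => //; split=> //.
  (* The new bound [M'] is at least the leading monomial of [a], so its weight is at most that of a
     standard monomial. *)
  apply: leq_ltn_trans (std_wdeg (LM_B_std nza)); apply: (le_wdeg le_adm).
  have /allP lowa := hspan_low (@downward_le M') VM'.
  by apply: lowa; exact: coordsA_LM_B.
have [/descend //|[q [h [c [Hh qhM stdM Vr]]]]] := hspan_leading VM.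
have [c0|nzc] := eqVneq c 0.
  by apply: descend; move: Vr; rewrite c0 scale0r subr0.
exists h => //; suff -> : LMB a = M by rewrite -qhM lem_addl.
apply: (LM_max le_adm); last exact: (allP (hspan_low (@downward_le M) VM)).
rewrite mcoeff_msupp -[a](subrK (c *: (tmon q * h))) coordsAD mcoeffD.
rewrite (low_lt_coef (hspan_low (@downward_lt M) Vr)) add0r coordsAZ mcoeffZ.
by rewrite -{1}qhM coef_LM_mul ?qhM // mulf_neq0 // LC_A_neq0 // H_mem_neq0.
Qed.

Lemma ideal_span_hspan a : ideal_span (fun h => h \in H) a -> hspan H predT a.
Proof.
move=> [s Hs ->]; rewrite big_seq; elim/big_ind: _ => [||c sc].
- exact: lspan0.
- exact: lspanD.
by apply: hspan_mull; [exact: Hs | apply/allP].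
Qed.

Lemma saturated_LM_dvd a : ideal_span (fun h => h \in H) a -> a != 0 ->
  exists2 h, h \in H & (LMB h <= LMB a)%MM.
Proof.
move=> /ideal_span_hspan /hspan_bounded[->|[M _ VM]]; first by rewrite eqxx.
by move=> nza; exact: hspan_LM_dvd VM.
Qed.

End Saturated.

(** * Runs of the procedure *)

Lemma stepP H' : step phi le G X H H' -> exists a,
  [/\ H' = rcons H (red a), red a != 0
    & forall J : {pred A}, left_ideal J -> {subset H <= J} -> a \in J].
Proof.
case=> [a g Ha Gg nz|a b Ha Hb nz].
  by exists (tilde phi le G X 'X_[mlcm (LMB a) (LM le g) - LMB a] * a); split=> //
    J [_ _ JM] HJ; apply/JM/HJ.
exists (tilde phi le G X (cofactor_of phi le G (mlcm (LMB a) (LMB b)) a) * a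
  - tilde phi le G X (cofactor_of phi le G (mlcm (LMB a) (LMB b)) b) * b).
split=> // J [_ JD JM] HJ; apply: JD; first exact/JM/HJ.
by rewrite -mulN1r; apply/JM/JM/HJ.
Qed.

End Reduction.

Lemma step_neq0 H H' : 0 \notin H -> step phi le G X H H' -> 0 \notin H'.
Proof.
by move=> H0 /stepP[a [-> nz _]]; rewrite mem_rcons inE eq_sym negb_or nz.
Qed.

(** In an infinite run, Dickson's lemma gives two appended elements such that the leading monomial
    of the earlier divides that of the later, which was reduced modulo the earlier one. *)
Lemma step_Acc H : 0 \notin H -> Acc (fun H2 H1 => step phi le G X H1 H2) H.
Proof.
move=> H0; apply: Acc_no_chain => u u0 ustep.
have nz i : 0 \notin u i.
  by elim: i => [|i IHi]; [rewrite u0 | apply: step_neq0 (ustep i)].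
(* The element appended at step [i]; the default 0 never arises, the list being nonempty after a
   step. *)
pose y i := last 0 (u i.+1).
have yP i : [/\ u i.+1 = rcons (u i) (y i)
    & forall h, h \in u i -> ~~ (LMB h <= LMB (y i))%MM].
  have [a [uE nzr _]] := stepP (ustep i).
  by rewrite /y uE last_rcons; split=> // h; exact: red_LM.
have yu i j : (i < j)%N -> y i \in u j.
  elim: j => // j IHj; have [-> _] := yP j; rewrite mem_rcons inE ltnS leq_eqVlt.
  by case/orP => [/eqP ->|/IHj ->]; rewrite ?eqxx ?orbT.
have [s [sinc smono]] := dickson_subseq (fun i => LMB (y i)).
have [_ /(_ (y (s 0)))] := yP (s 1); rewrite smono // => /(_ _)/negP; apply=> //.
exact: yu (sinc 0).
Qed.

Lemma steps_inv (J : {pred A}) H H' : left_ideal J -> 0 \notin H ->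
  {subset H <= J} -> steps phi le G X H H' ->
  [/\ 0 \notin H', {subset H <= H'} & {subset H' <= J}].
Proof.
move=> J_ideal H0 HJ Hs; elim: Hs H0 HJ => {H H'} [H H0 HJ|H H1 H2 H12 _ IH H0 HJ].
  by split.
have H10 := step_neq0 H0 H12; have [a [H1E _ Ja]] := stepP H12.
have [|H20 H12s H2J] := IH H10.
  move=> x; rewrite H1E mem_rcons inE => /orP[/eqP ->|/HJ //].
  by apply: red_mem => //; exact: Ja.
by split=> // x Hx; apply: H12s; rewrite H1E mem_rcons inE Hx orbT.
Qed.

(** [H'] still generates [J], as it lies between [H] and [J]; by the descent each leading monomial
    of [J] is then a multiple of one from [H']. *)
Lemma saturated_left_groebner (J : {pred A}) H H' : left_ideal J ->
  (forall a, a \in J <-> ideal_span (fun h => h \in H) a) ->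
  {subset H <= H'} -> {subset H' <= J} -> 0 \notin H' ->
  saturated phi le G X H' -> left_groebner le G X J H'.
Proof.
move=> [J0 JD JM] H_gen HH' H'J H'0 H'_sat.
have gen a : a \in J <-> ideal_span (fun h => h \in H') a.
  split=> [/H_gen|[s H's ->]].
    by apply: ideal_span_sub => h Hh; apply/ideal_span_mem/HH'.
  rewrite big_seq; elim/big_ind: _ => // c sc.
  exact/JM/H'J/H's.
split=> // f; split; apply: ideal_span_sub => y [].
  move=> a [nza /gen Ja ->]; have [h Hh leh] := saturated_LM_dvd H'0 H'_sat Ja nza.
  exists [:: ('X_[LMB a - LMB h], 'X_[LMB h])].
    by move=> c; rewrite inE => /eqP -> /=; exists h.
  by rewrite big_seq1 -mpolyXD submK.
move=> h Hh ->; apply: ideal_span_mem; exists h; split=> //; last exact: H'J.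
exact: H_mem_neq0 H'0 _ Hh.
Qed.

End Buchberger.

Theorem theorem1p1 (k : fieldType) (A : algType k) (F : filtration A)
    (gr_comm : forall u v : gr F, u * v = v * u)
    (n : nat) (d : 'I_n -> nat) (phi : {lrmorphism {mpoly k[n]} -> gr F})
    (phi_surj : forall u : gr F, exists f, phi f = u)
    (phi_homog : forall i, gr_homog (d i) (phi 'X_i))
    (le : rel 'X_{1..n}) (le_adm : degrev_admissible d le)
    (G : seq {mpoly k[n]}) (G_groebner : groebner le (fun f => phi f = 0) G)
    (X : 'I_n -> A) (X_lift : forall i, pr F (X i) = phi 'X_i)
    (J : {pred A}) (J_ideal : left_ideal J)
    (H : seq A) (H_uniq : uniq H) (H_neq0 : 0 \notin H)
    (H_gen : forall a, a \in J <-> ideal_span (fun h => h \in H) a) :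
  Acc (fun H2 H1 => step phi le G X H1 H2) H
  /\ forall H', steps phi le G X H H' -> saturated phi le G X H' ->
       {subset H <= H'} /\ left_groebner le G X J H'.
Proof.
have HJ : {subset H <= J} by move=> h Hh; apply/H_gen; exact: ideal_span_mem.
split; first exact: (step_Acc phi_surj phi_homog le_adm G_groebner X_lift).
move=> H' HH' H'_sat.
have [H'0 sHH' H'J] := steps_inv phi_surj phi_homog le_adm G_groebner X_lift
  J_ideal H_neq0 HJ HH'.
split=> //.
by apply: (saturated_left_groebner phi_surj phi_homog le_adm G_groebner X_lift)
  H_gen _ _ _ _.
Qed.
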